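(* For every $n\in\mathbb{N}$ there exists a constant $c_n>0$ such that for all convex sets $X,Y\subset\mathbb{R}^n$ of finite volume with $|X\cap Y|>0$, $$\frac{|\operatorname{co}(X\cup Y)|}{\min\{|X|,|Y|\}}-1\le c_n\,\frac{|X\triangle Y|}{|X\cap Y|}.$$
   Context: $|\cdot|$ denotes Lebesgue measure in $\mathbb{R}^n$; $\operatorname{co}$ denotes convex hull; $\triangle$ denotes symmetric difference. *)

(* Defs.v *)
From HB Require Import structures.
From mathcomp Require Import all_boot all_order all_algebra.
From mathcomp Require Import all_classical all_reals all_analysis.

Set Implicit Arguments.
Unset Strict Implicit.
Unset Printing Implicit Defensive.

Import Order.TTheory GRing.Theory Num.Theory.
Import numFieldNormedType.Exports.

Local Open Scope classical_set_scope.
Local Open Scope ring_scope.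

Definition box (R : realType) (n : nat) (a b : 'rV[R]_n) : set 'rV[R]_n :=
  [set x | forall i : 'I_n, x ord0 i \in `]a ord0 i, b ord0 i]].

Definition box_volume (R : realType) (n : nat) (a b : 'rV[R]_n) : R :=
  \prod_(i < n) Num.max 0 (b ord0 i - a ord0 i).

(* Lebesgue (outer) measure on R^n: infimum of the total volumes of the
   countable covers by boxes. It is Lebesgue measure on Lebesgue measurable
   sets; these include all convex sets, which need not be Borel when n >= 2, so
   that a measure on the product sigma-algebra would not be enough.
   The index set D allows finite covers: when n = 0 every box is the whole
   one-point space and has volume 1, so that infinite covers alone would give
   that space measure +oo instead of 1. *)
Definition lebesgue_rV (R : realType) (n : nat) (A : set 'rV[R]_n) : \bar R :=
  ereal_inf [set s : \bar R |
    exists (D : pred nat) (a b : nat -> 'rV[R]_n),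
      A `<=` \bigcup_(k in [set` D]) box (a k) (b k) /\
      s = (\sum_(k <oo | D k) (box_volume (a k) (b k))%:E)%E].

Definition convex_hull (R : realType) (n : nat) (A : set 'rV[R]_n) :
  set 'rV[R]_n := smallest (@convex_set R 'rV[R]_n) A.

(* Main.v *)
Require Import Defs.
From HB Require Import structures.
From mathcomp Require Import all_boot all_order all_algebra.
From mathcomp Require Import all_classical all_reals all_analysis.
From mathcomp Require Import perm measurable_realfun.
From mathcomp Require Import ring lra zify.
Set Implicit Arguments.
Unset Strict Implicit.
Unset Printing Implicit Defensive.
Import Order.TTheory GRing.Theory Num.Theory.
Import numFieldNormedType.Exports.
Local Open Scope classical_set_scope.
Local Open Scope ring_scope.
Local Open Scope ereal_scope.

(* Put K = X ∩ Y. A simplex in K of nearly maximal volume gives a norm e with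
   unit ball E such that E ⊆ K - c ⊆ C E, where C depends only on n.
   If |X Δ Y| ≥ |K|, a covering argument gives |co(X ∪ Y)| |K| ≤ C |X| |Y|,
   which suffices. Otherwise X and Y lie in a bounded multiple of E around c.
   Let p and q be their gauges. A point z of the gap co(X ∪ Y) \ (X ∪ Y) is
   z = u + v with p(u) + q(v) ≤ 1; choosing u and v to minimize p(u) + q(v), the
   map z ↦ u/2 + v is injective and shrinks volumes by a factor at most 2^n,
   while at its image p - q is at least (q(z) - p(u) - q(v)) / 2 when
   p(z) ≥ q(z). So the radial thickness of the gap is controlled by the radial
   thickness |p - q| of X Δ Y. Summing over the dilates by j/N and letting N
   tend to infinity turns thickness into volume. *)

(** * Lebesgue outer measure: subadditivity and scaling *)

(** No convex set is ever shown measurable. Upper bounds on outer measure come from subadditivity,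
    lower bounds from disjoint measurable pieces packed inside a set, and measurability is checked
    only for sets built from boxes and level sets of continuous functions. The case distinction is
    forced because the target is linear in |X Δ Y|: the covering bound does not tend to |K| as X and
    Y merge, so the gap itself has to be estimated when |X Δ Y| is small. The minimization over v
    runs over a finite net. On each cell v is constant, so the map z ↦ u/2 + v is a homothety of
    ratio 1/2 whose effect on volume is exact, and no change of variables is needed. The price is an
    error of order 1/N in the thickness, which vanishes in the limit. *)

Section lebesgue_rV_outer.
Variables (R : realType) (n : nat).
Local Notation V := 'rV[R]_n.
Implicit Types A B : set V.

Lemma box_volume_ge0 (a b : V) : (0 <= box_volume a b)%R.
Proof. by apply: prodr_ge0 => i _; rewrite le_max lexx. Qed.

Lemma lebesgue_rV_le_cover A (D : pred nat) (a b : nat -> V) :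
  A `<=` \bigcup_(k in [set` D]) box (a k) (b k) ->
  lebesgue_rV A <= \sum_(k <oo | D k) (box_volume (a k) (b k))%:E.
Proof. by move=> Aab; apply: ereal_inf_lbound; exists D, a, b. Qed.

Lemma lebesgue_rV_ge_cover A (x : \bar R) :
  (forall (D : pred nat) (a b : nat -> V),
    A `<=` \bigcup_(k in [set` D]) box (a k) (b k) ->
    x <= \sum_(k <oo | D k) (box_volume (a k) (b k))%:E) ->
  x <= lebesgue_rV A.
Proof. by move=> H; apply: le_ereal_inf_tmp => _ [D [a [b [Aab ->]]]]; exact: H. Qed.

Lemma lebesgue_rV_ge0 A : 0 <= lebesgue_rV A.
Proof.
apply: lebesgue_rV_ge_cover => D a b _.
by apply: nneseries_ge0 => k _ _; rewrite lee_fin box_volume_ge0.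
Qed.

Lemma lebesgue_rV0 : lebesgue_rV (set0 : set V) = 0.
Proof.
apply/eqP; rewrite eq_le lebesgue_rV_ge0 andbT.
apply: (le_trans (@lebesgue_rV_le_cover _ pred0 (fun=> 0%R) (fun=> 0%R) _)).
  by move=> x.
by rewrite eseries_pred0.
Qed.

Lemma lebesgue_rV_subset_sigma_subadditive A (F : nat -> set V) :
  subset_sigma_subadditive (@lebesgue_rV R n) A F.
Proof.
move=> AF.
have [[i ioo]|] := pselect (exists i, lebesgue_rV (F i) = +oo).
  rewrite (eseries_pinfty _ _ ioo) ?leey// => k _.
  by rewrite -ltNye (lt_le_trans _ (lebesgue_rV_ge0 _)).
rewrite -forallNE => Foo.
apply/lee_addgt0Pr => e e0.
rewrite (le_trans _ (epsilon_trick _ _ (ltW e0)))//; last first.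
  by move=> k; exact: lebesgue_rV_ge0.
pose P k (c : pred nat * ((nat -> V) * (nat -> V))) :=
  F k `<=` \bigcup_(i in [set` c.1]) box (c.2.1 i) (c.2.2 i) /\
  \sum_(i <oo | c.1 i) (box_volume (c.2.1 i) (c.2.2 i))%:E <=
    lebesgue_rV (F k) + (e / (2 ^ k.+1)%:R)%:E.
have [c Pc] : {c & forall k, P k (c k)}.
  apply: (@choice _ _ P) => k.
  have : lebesgue_rV (F k) < lebesgue_rV (F k) + (e / (2 ^ k.+1)%:R)%:E.
    rewrite lteDl ?lte_fin ?divr_gt0 ?ltr0n ?expn_gt0//.
    rewrite ge0_fin_numE ?lebesgue_rV_ge0// lt_neqAle leey andbT.
    exact/eqP/Foo.
  move=> /ereal_inf_lt[_ [D [a [b [Fab ->]]]] /ltW lt].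
  by exists (D, (a, b)).
pose v (ij : nat * nat) := (box_volume ((c ij.1).2.1 ij.2) ((c ij.1).2.2 ij.2))%:E.
have v0 ij : 0 <= v ij by rewrite lee_fin box_volume_ge0.
(* A bijection from [nat] to pairs merges the covers into one; [D'] keeps the pairs whose inner
   index is active. *)
have /card_esym/ppcard_eqP[f] := card_nat2.
pose D' k := (c (f k).1).1 (f k).2.
apply: (@le_trans _ _ (\sum_(k <oo | D' k) v (f k))).
  apply: (@lebesgue_rV_le_cover _ D' (fun k => (c (f k).1).2.1 (f k).2)
    (fun k => (c (f k).1).2.2 (f k).2)) => x /AF[i _] /(Pc i).1[j Dj xij].
  have fK : f (f^-1%FUN (i, j)) = (i, j) by rewrite invK ?inE.
  by exists (f^-1%FUN (i, j)); rewrite /= ?fK// unfold_in /D' fK.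
rewrite -(esum_pred_image v)//; last first.
  by move=> k l _ _; apply: (@inj _ _ _ f); rewrite inE.
have -> : [set f x | x in fun x => D' x] =
          setT `*`` (fun i => [set` (c i).1]).
  apply/seteqP; split => [_ [k Dk <-]|[i j] [_ /= Dij]]; first by split.
  have fK : f (f^-1%FUN (i, j)) = (i, j) by rewrite invK ?inE.
  by exists (f^-1%FUN (i, j)); rewrite /= /D' fK.
rewrite -(@esum_esum _ _ _ _ _ (fun i j => v (i, j)))//.
rewrite nneseries_esumT; last first.
  move=> i; rewrite adde_ge0 ?lebesgue_rV_ge0// lee_fin.
  by rewrite divr_ge0 ?ler0n ?ltW.
apply: le_esum => i _.
rewrite -nneseries_esum//; exact: (Pc i).2.
Qed.

HB.instance Definition _ := isSubsetOuterMeasure.Build R V (@lebesgue_rV R n)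
  lebesgue_rV0 lebesgue_rV_ge0 lebesgue_rV_subset_sigma_subadditive.

Lemma lebesgue_rV_affine_le (r : R) (w : V) A : (0 < r)%R ->
  lebesgue_rV [set r *: x + w | x in A]%R <= (r ^+ n)%:E * lebesgue_rV A.
Proof.
move=> r0; have rn0 : (0 < r ^+ n)%R by rewrite exprn_gt0.
rewrite -lee_pdivrMl//; apply: lebesgue_rV_ge_cover => D a b Aab.
rewrite lee_pdivrMl// -nneseriesZl; last first.
  by move=> i _; rewrite lee_fin box_volume_ge0.
apply: (le_trans (@lebesgue_rV_le_cover _ D
    (fun k => r *: a k + w)%R (fun k => r *: b k + w)%R _)).
  move=> _ [x /Aab[k Dk xk] <-]; exists k => //= i.
  by have := xk i; rewrite !mxE !in_itv/= ltrD2r lerD2r ltr_pM2l// ler_pM2l.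
apply: lee_nneseries => k *; first by rewrite lee_fin box_volume_ge0.
rewrite -EFinM lee_fin /box_volume.
rewrite [in leRHS](_ : r ^+ n = \prod_(i < n) r)%R; last first.
  by rewrite prodr_const card_ord.
rewrite -big_split/= ler_prod// => i _; rewrite le_max lexx/= !mxE.
by rewrite (maxr_pMr _ _ (ltW r0)) mulr0 opprD addrACA subrr addr0 mulrBr.

Qed.

Lemma lebesgue_rV_affine (r : R) (w : V) A : (0 < r)%R ->
  lebesgue_rV [set r *: x + w | x in A]%R = (r ^+ n)%:E * lebesgue_rV A.
Proof.
move=> r0; apply/eqP; rewrite eq_le lebesgue_rV_affine_le//=.
rewrite -lee_pdivlMl ?exprn_gt0// -exprVn.
have {1}-> : A = [set r^-1 *: y + (- (r^-1 *: w)) | y in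
                  [set r *: x + w | x in A]]%R.
  rewrite image_comp; rewrite -[LHS]image_id; apply: eq_imagel => x _ /=.
  by rewrite scalerDr scalerA mulVf ?gt_eqF// scale1r addrK.
by apply: lebesgue_rV_affine_le; rewrite invr_gt0.
Qed.

(* Bundled, because the measure on [caratheodory_type mu] is only inferred for a
   [mu] of type [{outer_measure _}]. *)
Definition lebesgue_outer : {outer_measure set V -> \bar R} := @lebesgue_rV R n.

End lebesgue_rV_outer.

(** * Carathéodory measurability of open sets *)

Section lebesgue_rV_measurable.
Variables (R : realType) (n : nat).
Local Notation V := 'rV[R]_n.
Local Notation mu := (lebesgue_outer R n).
Implicit Types A B : set V.

Definition set_coord (x : V) (i : 'I_n) (t : R) : V :=
  (\row_j if j == i then t else x ord0 j)%R.

Lemma box_volume_coord (a b a' b' : V) (i : 'I_n) :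
  (forall j, j != i -> a' ord0 j = a ord0 j /\ b' ord0 j = b ord0 j) ->
  box_volume a' b' = (Num.max 0 (b' ord0 i - a' ord0 i) *
    \prod_(j < n | j != i) Num.max 0 (b ord0 j - a ord0 j))%R.
Proof.
move=> ab'; rewrite /box_volume (bigD1 i)//=; congr (_ * _)%R.
by apply: eq_bigr => j /ab'[-> ->].
Qed.

Lemma max0_split (x y c : R) : (Num.max 0 (y - x) =
  Num.max 0 (Num.min y c - x) + Num.max 0 (y - Num.max x c))%R.
Proof.
rewrite !maxElt !minElt.
by case: (ltP y c) => ?; case: (ltP x c) => ?;
  do 3?[case: ifPn; rewrite -?leNgt => ?]; lra.
Qed.

(** Half-open boxes make the cut exact. When [c] misses the side, one piece has a nonpositive side,
    which [Num.max 0] counts as 0. *)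
Lemma box_volume_split (a b : V) (i : 'I_n) (c : R) :
  box_volume a b = (box_volume a (set_coord b i (Num.min (b ord0 i) c)) +
                    box_volume (set_coord a i (Num.max (a ord0 i) c)) b)%R.
Proof.
rewrite (@box_volume_coord a b a b i)//.
rewrite (@box_volume_coord a b a (set_coord b i _) i); last first.
  by move=> j /negbTE ji; rewrite !mxE ji.
rewrite (@box_volume_coord a b (set_coord a i _) b i); last first.
  by move=> j /negbTE ji; rewrite !mxE ji.
rewrite -mulrDl !mxE eqxx; congr (_ * _)%R.
exact: max0_split.
Qed.

(** Cutting every box at level [c] turns a cover of the test set into covers of its two parts with
    the same total volume. *)
Lemma lebesgue_rV_halfspace_measurable (i : 'I_n) (c : R) :
  mu.-caratheodory [set x | x ord0 i <= c]%R.
Proof.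
apply: le_caratheodory_measurable => X.
apply: lebesgue_rV_ge_cover => D a b Xab.
under eq_eseriesr do rewrite (@box_volume_split _ _ i c) EFinD.
rewrite nneseriesD; try by move=> k *; rewrite lee_fin box_volume_ge0.
apply: leeD; apply: lebesgue_rV_le_cover => x [/Xab[k Dk xk] /= xc];
  exists k => //= j; have := xk j; rewrite /set_coord !mxE !in_itv/=;
  case: eqVneq => // ->.
- by move=> /andP[-> bx]; rewrite le_min bx.
- by move=> /andP[ax ->]; rewrite gt_max ax ltNge andbT; exact/negP.
Qed.

Lemma lebesgue_rV_box_measurable (a b : V) : mu.-caratheodory (box a b).
Proof.
have -> : box a b = \bigcap_(i in [set: 'I_n])
    (~` [set x | x ord0 i <= a ord0 i]%R `&` [set x | x ord0 i <= b ord0 i]%R).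
  apply/seteqP; split => [x xab i _|x xab i].
    by have := xab i; rewrite in_itv => /andP[+ ?]; split => //=; apply/negP; rewrite -ltNge.
  by have [] := xab i I; rewrite in_itv/= => /negP; rewrite -ltNge => -> ->.
apply: (@fin_bigcap_measurable _ (caratheodory_type mu)) => // i _.
apply: measurableI; first apply: measurableC; exact: lebesgue_rV_halfspace_measurable.
Qed.

Lemma mx_norm_lt (x : V) (e : R) : (0 < e)%R ->
  (forall i, `|x ord0 i| < e)%R -> (`|x| < e)%R.
Proof.
move=> e0 xe; rewrite /Num.Def.normr/= mx_normrE.
apply/bigmax_ltP; split => // -[i j] _ /=; by rewrite (ord1 i).
Qed.

Lemma mx_norm_ler_coord (x : V) i : (`|x ord0 i| <= `|x|)%R.
Proof.
rewrite [in leRHS]/Num.Def.normr/= mx_normrE.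
by apply: (@le_bigmax _ _ _ _ (fun ij : 'I_1 * 'I_n => `|x ij.1 ij.2|%R) (ord0, i)).
Qed.

(** An open set is the union of the countably many boxes with rational centre and half-side 1/(k+1)
    that it contains. *)
Lemma lebesgue_rV_open_measurable A : open A -> mu.-caratheodory A.
Proof.
rewrite openE => oA.
pose Q : Type := ('rV[rat]_n * nat)%type.
pose a (q : Q) : V := (map_mx ratr q.1 - const_mx q.2.+1%:R^-1)%R.
pose b (q : Q) : V := (map_mx ratr q.1 + const_mx q.2.+1%:R^-1)%R.
pose F (q : Q) := if `[< box (a q) (b q) `<=` A >] then box (a q) (b q) else set0.
have -> : A = \bigcup_(q in [set: Q]) F q.
  apply/seteqP; split => [x Ax|x [q _]]; last first.
    by rewrite /F; case: asboolP => // qA /qA.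
  have /nbhs_normP[e /= e0 eA] := oA _ Ax.
  have [k k0] : exists k, (k.+1%:R^-1 < e / 2)%R.
    have e20 : (0 < e / 2)%R by rewrite divr_gt0.
    by have [k] := ltr_add_invr e20; rewrite add0r; exists k.
  have d0 : (0 < k.+1%:R^-1 :> R)%R by rewrite invr_gt0.
  have [d dE] : exists d : R, k.+1%:R^-1%R = d by exists k.+1%:R^-1%R.
  rewrite dE in k0 d0.
  have /choice[q qP] : forall i : 'I_n, exists q : rat,
      (x ord0 i - d < ratr q < x ord0 i + d)%R.
    move=> i; have xd : (x ord0 i - d < x ord0 i + d)%R by lra.
    by have [q] := rat_in_itvoo xd; rewrite in_itv/= => ?; exists q.
  exists ((\row_i q i)%R, k) => //; rewrite /F.
  case: asboolP => [_ i|].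
    have := qP i; rewrite !mxE dE in_itv/= => /andP[? ?].
    by apply/andP; split; lra.
  case; move=> y yq; apply: eA => /=; apply: mx_norm_lt => // i.
  have := yq i; have := qP i; rewrite !mxE dE in_itv/= => /andP[? ?] /andP[? ?].
  by rewrite ltr_norml; apply/andP; split; lra.
apply: (@countable_bigcupT_measurable _ (caratheodory_type mu)) => [|q].
  exact: (@countableP ('rV[rat]_n * nat)%type).
rewrite /F; case: ifP => _; [exact: lebesgue_rV_box_measurable|exact: measurable0].
Qed.

Lemma lebesgue_rV_bounded A (r : R) :
  (forall x, A x -> (`|x| <= r)%R) -> mu A < +oo.
Proof.
move=> Ar.
(* A single active box keeps the volume finite in dimension 0 too. The corner is -(r + 1) because
   boxes exclude their lower faces. *)
have := @lebesgue_rV_le_cover R n A (fun k => k == 0%N)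
  (fun=> const_mx (- (r + 1))%R) (fun=> const_mx r%R).
have -> : \sum_(k <oo | k == 0%N) (box_volume (const_mx (- (r + 1)) : V) (const_mx r))%:E
  = (box_volume (const_mx (- (r + 1)) : V) (const_mx r))%:E.
  rewrite (@nneseries_split_cond _ _ 0 1)//; last first.
    by move=> *; rewrite lee_fin box_volume_ge0.
  rewrite big_mkcond big_nat1 /= eseries0 ?adde0//.
  by move=> k + /eqP k0; rewrite k0.
move=> H; apply: le_lt_trans (H _) (ltry _) => x /Ar xr.
exists 0%N => //= i; rewrite !mxE in_itv/=.
have := le_trans (mx_norm_ler_coord x i) xr.
by rewrite ler_norml => /andP[? ?]; apply/andP; split => //; lra.
Qed.

End lebesgue_rV_measurable.

(** * Homotheties and disjoint families *)

Section lebesgue_rV_tools.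
Variables (R : realType) (n : nat).
Local Notation V := 'rV[R]_n.
Local Notation mu := (lebesgue_outer R n).
Implicit Types A B : set V.

Definition homothety (r : R) (w : V) A : set V := [set r *: x + w | x in A]%R.

Lemma homothetyE (r : R) (w : V) A : (0 < r)%R ->
  homothety r w A = [set y | A (r^-1 *: (y - w))]%R.
Proof.
move=> r0; apply/seteqP; split => [_ [x Ax <-]|y Ay] /=.
  by rewrite addrK scalerA mulVf ?gt_eqF// scale1r.
exists (r^-1 *: (y - w))%R => //.
by rewrite scalerA divff ?gt_eqF// scale1r subrK.
Qed.

Lemma mu_homothety (r : R) (w : V) A : (0 < r)%R ->
  mu (homothety r w A) = (r ^+ n)%:E * mu A.
Proof. exact: lebesgue_rV_affine. Qed.

Lemma homothetyK (r : R) (w : V) A : (0 < r)%R ->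
  homothety r w (homothety r^-1 (- (r^-1 *: w))%R A) = A.
Proof.
move=> r0; rewrite homothetyE// homothetyE ?invr_gt0// invrK.
rewrite (_ : (fun y => _) = A)//; apply/funext => y.
by rewrite /= opprK scalerDr !scalerA divff ?gt_eqF// !scale1r subrK.
Qed.

Lemma measurable_homothety (r : R) (w : V) A : (0 < r)%R ->
  mu.-caratheodory A -> mu.-caratheodory (homothety r w A).
Proof.
move=> r0 mA X; rewrite -(homothetyK w X r0).
move: (homothety r^-1 _ X) => X'.
have -> : homothety r w X' `&` homothety r w A = homothety r w (X' `&` A).
  by rewrite !homothetyE.
have -> : homothety r w X' `&` ~` homothety r w A = homothety r w (X' `&` ~` A).
  by rewrite !homothetyE.
rewrite !mu_homothety// (mA X').
by apply: ge0_muleDr; exact: outer_measure_ge0.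
Qed.

Lemma mu_fin_real A : mu A < +oo -> exists x, mu A = x%:E.
Proof.
by move=> Aoo; exists (fine (mu A)); rewrite fineK// ge0_fin_numE ?outer_measure_ge0.
Qed.

(** Lower bounds on volume come from here. Only the pieces have to be measurable, so [B] can be an
    arbitrary convex set. *)
Lemma sum_disjoint_le (I : finType) (F : I -> set V) B :
  (forall i, mu.-caratheodory (F i)) ->
  (forall i j x, F i x -> F j x -> i = j) ->
  (forall i, F i `<=` B) -> \sum_(i : I) mu (F i) <= mu B.
Proof.
move=> mF F_inj FB.
have <- : mu (\bigcup_(i in [set: I]) F i) = \sum_(i : I) mu (F i).
  rewrite (@measure_fin_bigcup _ _ (caratheodory_type mu) mu)//.
    rewrite (fsbigE (index_enum I)) ?index_enum_uniq//; last first.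
      by move=> i _; rewrite mem_index_enum.
    by apply: eq_bigl => i; rewrite in_setT.
    exact: finite_finset.
  by move=> i j _ _ [x [Fi Fj]]; exact: F_inj Fi Fj.
  by move=> i _; exact: mF.
by apply: le_outer_measure => x [i _]; exact: FB.
Qed.

End lebesgue_rV_tools.

(** * Seminorms and their balls *)

Section seminorm.
Variables (R : realType) (n : nat).
Local Notation V := 'rV[R]_n.
Local Notation mu := (lebesgue_outer R n).
Implicit Types A B : set V.

(** The bound [semin_bd] by the sup norm makes [e] continuous, so its balls are open and hence
    measurable. *)
Record is_seminorm (e : V -> R) : Prop := {
  semin_leD : forall x y, (e (x + y) <= e x + e y)%R ;
  seminZ : forall a x, (e (a *: x) = `|a| * e x)%R ;
  semin_bd : exists M, forall x, (e x <= M * `|x|)%R }.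

Definition eball (e : V -> R) (r : R) : set V := [set x | e x < r]%R.

Variable e : V -> R.
Hypothesis eP : is_seminorm e.

Lemma semin0 : (e 0 = 0)%R.
Proof. by rewrite -(scale0r 0) (seminZ eP) normr0 mul0r. Qed.

Lemma seminN x : (e (- x) = e x)%R.
Proof. by rewrite -scaleN1r (seminZ eP) normrN1 mul1r. Qed.

Lemma semin_ge0 x : (0 <= e x)%R.
Proof.
have := semin_leD eP x (- x); rewrite subrr semin0 seminN => ?; lra.
Qed.

Lemma semin_distC x y : (e (x - y) = e (y - x))%R.
Proof. by rewrite -seminN opprB. Qed.

Lemma semin_tri x y z : (e (x - z) <= e (x - y) + e (y - z))%R.
Proof. by apply: le_trans (semin_leD eP _ _); rewrite addrA subrK. Qed.

Lemma lipschitz_continuous (f : V -> R) (M : R) :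
  (forall x y, `|f x - f y| <= M * e (x - y))%R -> continuous f.
Proof.
move=> fM; have [M' eM] := semin_bd eP.
pose K := (`|M| * (`|M'| + 1) + 1)%R.
have K0 : (0 < K)%R by rewrite ltr_pwDr// mulr_ge0// addr_ge0.
move=> x U /nbhs_normP[d /= d0 dU].
have dK : (0 < d / K)%R by rewrite divr_gt0.
apply: filterS (@nbhs_ball_norm R V x (PosNum dK)).
move=> y /=; rewrite ltr_pdivlMr// => xy; apply: dU => /=; apply: le_lt_trans xy.
apply: (le_trans (fM _ _)); rewrite mulrC.
have e1 : (e (x - y) <= (`|M'| + 1) * `|x - y|)%R.
  apply: (le_trans (eM _)); rewrite ler_wpM2r//.
  by rewrite (le_trans (ler_norm _))// lerDl.
apply: (@le_trans _ _ (`|M| * ((`|M'| + 1) * `|x - y|))%R).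
  rewrite mulrC (@le_trans _ _ (`|M| * e (x - y))%R)//.
    by rewrite ler_wpM2r ?semin_ge0// ler_norm.
  by rewrite ler_wpM2l.
by rewrite /K mulrDr mulr1 mulrA [leRHS]addrC mulrC -[leLHS]add0r lerD// mulrC.
Qed.

Lemma measurable_lt (f : V -> R) (c : R) :
  continuous f -> mu.-caratheodory [set x | f x < c]%R.
Proof.
move=> cf; apply: lebesgue_rV_open_measurable.
exact: (open_comp (fun x _ => cf x) (@open_lt _ c)).
Qed.

Lemma measurable_gt (f : V -> R) (c : R) :
  continuous f -> mu.-caratheodory [set x | c < f x]%R.
Proof.
move=> cf; apply: lebesgue_rV_open_measurable.
exact: (open_comp (fun x _ => cf x) (@open_gt _ c)).
Qed.

Lemma measurable_le (f : V -> R) (c : R) :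
  continuous f -> mu.-caratheodory [set x | f x <= c]%R.
Proof.
move=> cf; have -> : [set x | f x <= c]%R = ~` [set x | c < f x]%R.
  by apply/seteqP; split => x /=; rewrite leNgt => /negP.
exact/(@measurableC _ (caratheodory_type mu))/measurable_gt.
Qed.

Lemma measurable_ge (f : V -> R) (c : R) :
  continuous f -> mu.-caratheodory [set x | c <= f x]%R.
Proof.
move=> cf; have -> : [set x | c <= f x]%R = ~` [set x | f x < c]%R.
  by apply/seteqP; split => x /=; rewrite leNgt => /negP.
exact/(@measurableC _ (caratheodory_type mu))/measurable_lt.
Qed.

Lemma semin_continuous : continuous e.
Proof.
apply: (@lipschitz_continuous _ 1) => x y; rewrite mul1r ler_norml.
apply/andP; split.
  have := semin_leD eP x (y - x); rewrite addrC subrK semin_distC => ?; lra.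
have := semin_leD eP y (x - y); rewrite addrC subrK => ?; lra.
Qed.

Lemma measurable_eball r : mu.-caratheodory (eball e r).
Proof. exact/measurable_lt/semin_continuous. Qed.

Lemma homothety_eball (r s : R) w : (0 < r)%R ->
  homothety r w (eball e s) = [set x | e (x - w) < r * s]%R.
Proof.
move=> r0; rewrite homothetyE//; apply/seteqP.
by split => x /=; rewrite /eball/= (seminZ eP) gtr0_norm ?invr_gt0// ltr_pdivrMl.
Qed.

Lemma eball_homothety (r : R) : (0 < r)%R -> eball e r = homothety r 0 (eball e 1).
Proof.
by move=> r0; rewrite homothety_eball//; apply/seteqP; split => x;
  rewrite /eball/= subr0 mulr1.
Qed.

Lemma mu_eball (r : R) : (0 < r)%R -> mu (eball e r) = (r ^+ n)%:E * mu (eball e 1).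
Proof. by move=> r0; rewrite eball_homothety// mu_homothety. Qed.

End seminorm.

(** * Convex sets: coverings and volume bounds *)

Section convexity.
Variables (R : realType) (n : nat).
Local Notation V := 'rV[R]_n.
Implicit Types X Y : set V.
Local Open Scope ring_scope.

Lemma convex_setP X : convex_set X <->
  forall x y a b, X x -> X y -> 0 <= a -> 0 <= b -> a + b = 1 ->
    X (a *: x + b *: y).
Proof.
split=> [cX x y a b Xx Xy a0 b0 ab|cX x y l]; last first.
  rewrite !inE => Xx Xy; apply: cX => //.
    by rewrite /unstable.onem subr_ge0.
  by rewrite /unstable.onem addrC subrK.
have a1 : a <= 1 by rewrite -ab lerDl.
have := cX x y (Itv01 a0 a1) (mem_set Xx) (mem_set Xy); rewrite inE.
by have -> : b = unstable.onem a by rewrite /unstable.onem; lra.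
Qed.

Lemma convex_cone X x y a b : convex_set X -> X x -> X y -> 0 <= a -> 0 <= b ->
  exists2 z, X z & a *: x + b *: y = (a + b) *: z.
Proof.
move=> /convex_setP cX Xx Xy a0 b0.
have [ab0|ab0] := eqVneq (a + b) 0.
  exists x => //; have [-> ->] : a = 0 /\ b = 0 by split; lra.
  by rewrite addr0 !scale0r addr0.
exists (((a + b)^-1 * a) *: x + ((a + b)^-1 * b) *: y).
  by apply: cX => //; rewrite ?mulr_ge0 ?invr_ge0 ?addr_ge0// -mulrDr mulVf.
by rewrite -!scalerA -scalerDr scalerA divff// scale1r.
Qed.

Lemma convex_hullU X Y x0 y0 : convex_set X -> convex_set Y -> X x0 -> Y y0 ->
  forall z, convex_hull (X `|` Y) z -> exists x y a b,
    [/\ X x, Y y, 0 <= a, 0 <= b & a + b = 1 /\ z = a *: x + b *: y].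
Proof.
move=> cX cY Xx0 Yy0 z.
pose C : set V := [set z | exists x y a b,
    [/\ X x, Y y, 0 <= a, 0 <= b & a + b = 1 /\ z = a *: x + b *: y]].
apply: (@smallest_sub _ _ _ C).
  apply/convex_setP => _ _ s t
    [x [y [a [b [Xx Yy a0 b0 [ab ->]]]]]] [x' [y' [a' [b' [Xx' Yy' a'0 b'0 [ab' ->]]]]]] s0 t0 st.
  have [x2 Xx2 x2E] := convex_cone cX Xx Xx' (mulr_ge0 s0 a0) (mulr_ge0 t0 a'0).
  have [y2 Yy2 y2E] := convex_cone cY Yy Yy' (mulr_ge0 s0 b0) (mulr_ge0 t0 b'0).
  exists x2, y2, (s * a + t * a'), (s * b + t * b'); split => //.
  - by rewrite addr_ge0 ?mulr_ge0.
  - by rewrite addr_ge0 ?mulr_ge0.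
  - rewrite -x2E -y2E !scalerDr !scalerA; split; last by rewrite addrACA.
    by rewrite addrACA -!mulrDr ab ab' !mulr1.
move=> u [Xu|Yu].
  by exists u, y0, 1, 0; rewrite scale1r scale0r !addr0; split.
by exists x0, u, 0, 1; rewrite scale1r scale0r !add0r; split.
Qed.

End convexity.

Lemma sum_const_ereal (R : realType) (m : nat) (c : \bar R) : 0 <= c ->
  \sum_(i < m) c = m%:R%:E * c.
Proof.
move=> c0; elim: m => [|m IH]; first by rewrite big_ord0 mul0e.
by rewrite big_ord_recr/= IH -natr1 EFinD ge0_muleDl ?mul1e.
Qed.

Section finite_cover.
Variables (R : realType) (n : nat).
Local Notation V := 'rV[R]_n.
Local Notation mu := (lebesgue_outer R n).

Lemma mu_le_sum (I : eqType) (s : seq I) (F : I -> set V) (A : set V) :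
  (forall x, A x -> exists2 i, i \in s & F i x) ->
  mu A <= \sum_(i <- s) mu (F i).
Proof.
elim: s A => [|i s IH] A AF.
  rewrite big_nil (_ : A = set0) ?outer_measure0//.
  by apply/seteqP; split => // x /AF[].
rewrite big_cons.
have -> : A = (A `&` F i) `|` (A `&` ~` F i) by rewrite -setIUr setUCr setIT.
apply: (le_trans (outer_measureU2 _ _ _)); apply: leeD.
  by apply: le_outer_measure => x [].
apply: IH => x [/AF[j]]; rewrite inE => /orP[/eqP-> //|js Fj _].
by exists j.
Qed.

End finite_cover.

Section geometry.
Variables (R : realType) (n : nat).
Local Notation V := 'rV[R]_n.
Local Notation mu := (lebesgue_outer R n).
Variable e : V -> R.
Hypothesis eP : is_seminorm e.
Implicit Types A B X Y : set V.

(** Balls of radius 1/2 centred on the first half of the segment from 0 to [x], at mutual distance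
    at least 1, are disjoint and lie in [X]. There are more than e(x)/2 of them, each of volume 2^-n
    |E|. *)
Lemma stretch X x : convex_set X -> eball e 1 `<=` X -> X x ->
  (e x)%:E * mu (eball e 1) <= (2 ^+ n.+1)%:E * mu X.
Proof.
move=> /convex_setP cX eX Xx; have e0 := semin_ge0 eP x.
have [ex0|ex0] := eqVneq (e x) 0%R.
  by rewrite ex0 mul0e mule_ge0 ?outer_measure_ge0// lee_fin exprn_ge0.
have ex1 : (0 < e x)%R by rewrite lt_neqAle eq_sym ex0.
pose m := Num.trunc (e x / 2).
have /andP[m1 m2] : (m%:R <= e x / 2 < m.+1%:R)%R.
  by apply: truncn_itv; rewrite divr_ge0.
pose F (i : 'I_m.+1) := homothety 2^-1 ((i%:R / e x) *: x) (eball e 1).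
have i2 (i : 'I_m.+1) : (i%:R / e x <= 2^-1)%R.
  rewrite ler_pdivrMr//; apply: (@le_trans _ _ m%:R)%R; last by rewrite mulrC.
  by rewrite ler_nat -ltnS.
have h0 : (0 < 2^-1 :> R)%R by [].
have : \sum_(i < m.+1) mu (F i) <= mu X.
  apply: sum_disjoint_le => [i|i j z|i].
  - by apply: measurable_homothety => //; exact: measurable_eball.
  - rewrite /F !homothety_eball//= => zi zj; apply/eqP; apply/negPn/negP => ij.
    have := semin_tri eP ((i%:R / e x) *: x) z ((j%:R / e x) *: x).
    rewrite -scalerBl (seminZ eP) -mulrBl normrM normfV (gtr0_norm ex1) mulfVK//.
    rewrite (semin_distC eP _ z).
    have : (1 <= `|i%:R - j%:R| :> R)%R.
      rewrite -(intrB _ i%:Z j%:Z) -intr_norm -[1%R]/(1%:~R)%R ler_int.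
      rewrite -gtz0_ge1 normr_gt0 subr_eq0.
      by apply: contra ij => /eqP [?]; apply/eqP/val_inj.
    move=> ? ?; lra.
  - rewrite /F => _ [y y1 <-]; rewrite addrC.
    have t0 : (0 <= i%:R / e x)%R by rewrite divr_ge0.
    have t1 := i2 i; set t := (i%:R / e x)%R in t0 t1 *.
    (* Since t <= 1/2, the vector y / (2 (1 - t)) still lies in the unit ball. *)
    have -> : (2^-1 *: y = (1 - t) *: ((1 - t)^-1 *: (2^-1 *: y)))%R.
      by rewrite [RHS]scalerA divff ?scale1r//; apply/eqP; lra.
    apply: cX => //; try lra.
    apply: eX; rewrite /eball/= !(seminZ eP) !ger0_norm ?invr_ge0//; last lra.
    rewrite ltr_pdivrMl; last lra.
    rewrite ltr_pdivrMl// mulr1; rewrite /eball/= in y1; lra.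
under eq_bigr do rewrite /F mu_homothety//.
rewrite sum_const_ereal ?mule_ge0 ?outer_measure_ge0// exprVn => H.
rewrite -lee_pdivrMl ?exprn_gt0// (le_trans _ H)// !muleA -!EFinM lee_wpmul2r//.
rewrite lee_fin exprS invfM mulrAC ler_pM2r ?invr_gt0 ?exprn_gt0//.
by rewrite mulrC ltW.
Qed.


(** A longest 2r-separated list in [A] works: its r-balls are disjoint inside [B], and by maximality
    its 2r-balls cover [A]. Such a list exists because volume bounds the length. *)
Lemma packing A B (r : R) : (0 < r)%R -> 0 < mu (eball e 1) -> mu B < +oo ->
  (forall a y, A a -> (e y < r)%R -> B (a + y)%R) ->
  exists s : seq V, [/\ forall a, a \in s -> A a,
    forall x, A x -> exists2 a, a \in s & (e (x - a) < 2 * r)%R &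
    (size s)%:R%:E * mu (eball e r) <= mu B].
Proof.
move=> r0 e0 Boo AB.
have er0 : 0 < mu (eball e r) by rewrite mu_eball// mule_gt0// lte_fin exprn_gt0.
pose sep (s : seq V) := (forall a, a \in s -> A a) /\
  pairwise (fun a b => 2 * r <= e (a - b))%R s.
have sepP s : sep s -> (size s)%:R%:E * mu (eball e r) <= mu B.
  move=> [sA /(pairwiseP 0%R) sS].
  pose F (i : 'I_(size s)) := homothety 1 s`_i (eball e r).
  have r1 : (0 < 1 :> R)%R by [].
  have -> : (size s)%:R%:E * mu (eball e r) = \sum_(i < size s) mu (F i).
    under eq_bigr do rewrite /F mu_homothety// expr1n mul1e.
    by rewrite sum_const_ereal// ltW.
  apply: sum_disjoint_le => [i|i j z|i].
  - by apply: measurable_homothety => //; exact: measurable_eball.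
  - rewrite /F !homothety_eball//= !mul1r => zi zj; apply/eqP/negPn/negP => ij.
    have [lt|lt|/val_inj eqij] := ltngtP i j; last by rewrite eqij eqxx in ij.
      have := sS i j (ltn_ord i) (ltn_ord j) lt.
      have := semin_tri eP s`_i z s`_j; rewrite (semin_distC eP _ z) => ? ?; lra.
    have := sS j i (ltn_ord j) (ltn_ord i) lt.
    have := semin_tri eP s`_j z s`_i; rewrite (semin_distC eP _ z) => ? ?; lra.
  - move=> _ [y yr <-]; rewrite scale1r addrC; apply: AB => //.
    by apply: sA; rewrite mem_nth.
have [N NP] : exists N : nat, forall s, sep s -> (size s <= N)%N.
  have Bfin : mu B \is a fin_num by rewrite ge0_fin_numE ?outer_measure_ge0.
  (* The ball is known to be finite only once some translate of it fits in [B]. *)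
  have er_fin s : sep s -> s != [::] -> mu (eball e r) \is a fin_num.
    case: s => // a s /sepP /= H _; rewrite ge0_fin_numE ?outer_measure_ge0//.
    apply: le_lt_trans Boo; apply: le_trans H.
    by rewrite -[leLHS]mul1e lee_wpmul2r ?outer_measure_ge0// lee_fin ler1n.
  exists (Num.trunc (fine (mu B) / fine (mu (eball e r)))) => s ss.
  have [->//|s0] := eqVneq s [::].
  have efin := er_fin _ ss s0; have := sepP _ ss.
  have fe0 : (0 < fine (mu (eball e r)))%R by rewrite fine_gt0// er0 -ge0_fin_numE ?outer_measure_ge0.
  rewrite -(fineK efin) -(fineK Bfin) -EFinM lee_fin -ler_pdivlMr// => H.
  by rewrite /= truncn_ge_nat// divr_ge0 ?fine_ge0 ?outer_measure_ge0.
have [s [ss smax]] : exists s, sep s /\ forall s', sep s' -> (size s' <= size s)%N.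
  pose P k := `[< exists2 s, sep s & size s = k >].
  have P0 : exists k, P k by exists 0%N; apply/asboolP; exists [::].
  have Pb k : P k -> (k <= N)%N by move=> /asboolP[s ss <-]; exact: NP.
  case: (ex_maxnP P0 Pb) => k /asboolP[s ss sk] kmax.
  by exists s; split => // s' ss'; rewrite sk; apply: kmax; apply/asboolP; exists s'.
exists s; split; [exact: ss.1| |exact: sepP].
move=> x Ax; apply: contrapT => xs.
suff : sep (x :: s) by move=> /smax /=; rewrite ltnn.
split=> [a|/=]; first by rewrite inE => /orP[/eqP->//|]; exact: ss.1.
rewrite ss.2 andbT; apply/allP => a sa; rewrite leNgt; apply/negP => xa.
by apply: xs; exists a.
Qed.

(* A crude form of the Rogers-Shephard inequality: cover X and Y by few
   translates of a ball, then X + Y by their pairwise sums. *)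
Lemma mu_hull_le X Y : convex_set X -> convex_set Y ->
  eball e 1 `<=` X -> eball e 1 `<=` Y -> 0 < mu (eball e 1) ->
  mu X < +oo -> mu Y < +oo ->
  mu (convex_hull (X `|` Y)) * mu (eball e 1) <= (16 ^+ n)%:E * (mu X * mu Y).
Proof.
move=> cX cY eX eY e0 Xoo Yoo.
have cover Z : convex_set Z -> eball e 1 `<=` Z -> mu Z < +oo ->
  exists s : seq V, (forall z, Z z -> exists2 a, a \in s & (e (z - a) < 2)%R) /\
    (size s)%:R%:E * mu (eball e 1) <= (2 ^+ n)%:E * mu Z.
  move=> cZ eZ Zoo.
  (* For a in Z and y in E, a + y is twice a midpoint of points of Z, so unit balls around Z stay in
     2Z. *)
  have := @packing Z (homothety 2 0 Z) 1 ltr01 e0; rewrite mu_homothety// mulr1.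
  case; first by rewrite lte_mul_pinfty// lee_fin exprn_ge0.
    move=> a y Za y1.
    exists (2^-1 *: a + 2^-1 *: y)%R.
      by move/convex_setP : cZ; apply => //; [exact: eZ|lra].
    by rewrite scalerDr !scalerA divff// !scale1r addr0.
  by move=> s [_ sZ sle]; exists s.
have [s [sX sle]] := cover X cX eX Xoo.
have [t [tY tle]] := cover Y cY eY Yoo.
have e4 : mu (eball e 4) = (4 ^+ n)%:E * mu (eball e 1) by rewrite mu_eball.
have : mu (convex_hull (X `|` Y)) <=
    (size (allpairs pair s t))%:R%:E * mu (eball e 4).
  rewrite -sum_const_ereal ?outer_measure_ge0//.
  pose F (ab : V * V) := homothety 1 (ab.1 + ab.2)%R (eball e 4).
  have -> : \sum_(i < size (allpairs pair s t)) mu (eball e 4) =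
      \sum_(ab <- allpairs pair s t) mu (F ab).
    rewrite (big_nth (0, 0)%R) big_mkord; apply: eq_bigr => i _.
    by rewrite /F mu_homothety// expr1n mul1e.
  apply: mu_le_sum.
  have e00 : eball e 1 0%R by rewrite /eball/= (semin0 eP).
  move=> z /(convex_hullU cX cY (eX _ e00) (eY _ e00))[x [y [a [b [Xx Yy a0 b0 [ab ->]]]]]].
  (* As 0 lies in both sets, [a *: x] is in X and [b *: y] in Y, so the hull lies in X + Y. *)
  have axX : X (a *: x)%R.
    rewrite -[(a *: x)%R]addr0 -(scaler0 _ b).
    by move/convex_setP : cX; apply => //; exact: eX.
  have byY : Y (b *: y)%R.
    rewrite -[(b *: y)%R]add0r -(scaler0 _ a).
    by move/convex_setP : cY; apply => //; exact: eY.
  have [x' sx' xx'] := sX _ axX; have [y' ty' yy'] := tY _ byY.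
  exists (x', y'); first by apply/allpairsP; exists (x', y').
  rewrite /F homothety_eball//= mul1r opprD addrACA.
  have := semin_leD eP (a *: x - x') (b *: y - y'); lra.
rewrite size_allpairs natrM EFinM e4 => H.
apply: (le_trans (lee_wpmul2r (outer_measure_ge0 _ _) H)).
have eoo : mu (eball e 1) < +oo by apply: le_lt_trans Xoo; exact: le_outer_measure.
have [x xE] := mu_fin_real Xoo; have [y yE] := mu_fin_real Yoo; have [m mE] := mu_fin_real eoo.
have m0 : (0 <= m)%R by rewrite -lee_fin -mE outer_measure_ge0.
move: sle tle; rewrite xE yE mE -!EFinM !lee_fin => sle tle.
(* A factor 4^n comes from the balls of radius 4, and 2^n from each of the two coverings. *)
have -> : (16 ^+ n * (x * y) = 4 ^+ n * (2 ^+ n * x * (2 ^+ n * y)))%R.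
  have -> : (16 = 4 * 2 * 2 :> R)%R by ring.
  by rewrite !exprMn; ring.
have -> : ((size s)%:R * (size t)%:R * (4 ^+ n * m) * m =
  4 ^+ n * ((size s)%:R * m * ((size t)%:R * m)))%R by ring.
by rewrite ler_wpM2l ?exprn_ge0// ler_pM// mulr_ge0.
Qed.

End geometry.

(** * Minimizing decompositions and the gap *)

Section counting.

(** Integrating indicators turns a pointwise comparison of multiplicities into one between sums of
    volumes. *)
Lemma count_measure_le d (T : measurableType d) (R : realType)
    (mu : {measure set T -> \bar R}) (D : set T) (K J : nat)
    (A : 'I_K -> set T) (B : 'I_J -> set T) (a b : nat) :
  measurable D -> (forall k, measurable (A k)) -> (forall j, measurable (B j)) ->
  (forall k, A k `<=` D) -> (forall j, B j `<=` D) ->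
  (forall x, D x -> (\sum_(k < K) (x \in A k) <= a * \sum_(j < J) (x \in B j) + b)%N) ->
  \sum_(k < K) mu (A k) <= a%:R%:E * \sum_(j < J) mu (B j) + b%:R%:E * mu D.
Proof.
move=> mD mA mB AD BD AB.
have sumE (m : nat) (F : 'I_m -> set T) : (forall i, measurable (F i)) ->
    (forall i, F i `<=` D) ->
    \sum_(i < m) mu (F i) = \int[mu]_(x in D) \sum_(i < m) (\1_(F i) x)%:E.
  move=> mF FD; rewrite ge0_integral_sum//.
  - by apply: eq_bigr => i _; rewrite integral_indic// setIidl.
  - by move=> i; exact/measurable_EFinP/measurable_indic.
have nnB x : (0 : \bar R) <= \sum_(j < J) (\1_(B j) x)%:E by apply: sume_ge0.
have msum (m : nat) (F : 'I_m -> set T) : (forall i, measurable (F i)) ->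
    measurable_fun D (fun x => \sum_(i < m) (\1_(F i) x)%:E : \bar R).
  by move=> mF; apply: emeasurable_sum => i; exact/measurable_EFinP/measurable_indic.
rewrite !sumE// -integral_cst// -ge0_integralZl//; last exact: msum.
rewrite -ge0_integralD//; first last.
- by move=> x _; rewrite /= lee_fin ler0n.
- by apply: emeasurable_funM => //; exact: msum.
- by move=> x _; rewrite mule_ge0// lee_fin ler0n.
apply: ge0_le_integral => //.
- by move=> x _; exact: sume_ge0.
- exact: msum.
- by apply: emeasurable_funD => //; apply: emeasurable_funM => //; exact: msum.
move=> x Dx; rewrite !sumEFin -!EFinM -EFinD lee_fin.
have indE (m : nat) (F : 'I_m -> set T) :
    (\sum_(i < m) \1_(F i) x = (\sum_(i < m) (x \in F i))%N%:R :> R)%R.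
  by rewrite natr_sum; apply: eq_bigr => i _; rewrite indicE.
by rewrite !indE -natrM -natrD ler_nat AB.
Qed.

Lemma card_ord_ub (K m : nat) (S : pred 'I_K) :
  (forall i j : 'I_K, S i -> S j -> (j <= i + m)%N) ->
  (\sum_(k < K) S k <= m.+1)%N.
Proof.
move=> Sm; rewrite -big_mkcond sum1_card.
have [k0 Sk0|S0] := pickP S; last by rewrite eq_card0.
case: (arg_minnP (fun i : 'I_K => i : nat) Sk0) => a Sa amin.
rewrite -(size_iota a m.+1) cardE -(size_map val).
apply: uniq_leq_size; first by rewrite (map_inj_uniq val_inj) enum_uniq.
move=> _ /mapP[j + ->]; rewrite mem_enum => Sj.
by rewrite mem_iota amin//= addnS ltnS Sm.
Qed.

Lemma card_ord_lb (J t l : nat) (S : pred 'I_J) :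
  (forall i : 'I_J, (t <= i < t + l)%N -> S i) -> (t + l <= J)%N ->
  (l <= \sum_(j < J) S j)%N.
Proof.
move=> St tlJ; rewrite -big_mkcond sum1_card.
rewrite -[leqLHS](size_iota t) cardE -(size_map val).
apply: uniq_leq_size; first exact: iota_uniq.
move=> i; rewrite mem_iota => til.
have iJ : (i < J)%N by case/andP: til => _ /leq_trans; apply.
apply/mapP; exists (Ordinal iJ) => //.
by rewrite mem_enum; exact: St.
Qed.

(* An interval of length about 2(y - x) on one side contains at most about
   twice as many multiples of 1/N as the interval ]x, y[ does. *)
Lemma count_compare (R : realType) (N J : nat) (lo hi x y : R) :
  (0 < N)%N -> (0 <= x)%R -> (N%:R * y <= J%:R)%R -> (hi - lo <= 2 * (y - x))%R ->
  (\sum_(k < N) ((lo <= (N + k)%:R / N%:R + N%:R^-1)%R && ((N + k)%:R / N%:R <= hi)%R) <=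
   2 * \sum_(j < J) ((x < j.+1%:R / N%:R)%R && (j.+1%:R / N%:R < y)%R) + 4)%N.
Proof.
move=> N0 x0 yJ hl; have N0' : (0 < N%:R :> R)%R by rewrite ltr0n.
set c := (\sum_(j < J) _)%N.
have -> : (2 * c + 4 = (2 * c + 3).+1)%N by rewrite addnS.
apply: card_ord_ub => a b /andP[a1 _] /andP[_ b2].
rewrite leqNgt; apply/negP => ab.
(* If two hits a < b differ by at least 2c + 4, then N (y - x) >= c + 3/2, so the c + 1 multiples
   (t+1)/N, ..., (t+c+1)/N all lie in ]x, y[, one more than were counted. *)
pose t := Num.trunc (N%:R * x); pose l := c.+1.
have /andP[t1 t2] : (t%:R <= N%:R * x < t.+1%:R)%R.
  by apply: truncn_itv; rewrite mulr_ge0// ltW.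
have dbl : (b%:R - a%:R - 1 <= 2 * (N%:R * y - N%:R * x))%R.
  rewrite ler_pdivrMr// in b2.
  have : (lo * N%:R <= (N + a)%:R + 1)%R.
    have := ler_wpM2r (ltW N0') a1.
    by rewrite mulrDl divfK ?gt_eqF// mulVf ?gt_eqF.
  have := ler_wpM2r (ltW N0') hl.
  rewrite !natrD in b2 *; rewrite (mulrBl _ hi) -!mulrA (mulrBl _ y) !(mulrC _ N%:R).
  move=> ? ?; lra.
have tl : (t%:R + l%:R < N%:R * y)%R.
  have : (a%:R + 2 * c%:R + 4 <= b%:R :> R)%R.
    by rewrite -natrM -!natrD ler_nat; lia.
  rewrite -[l%:R]natr1 => ?; lra.
have : (l <= c)%N.
  apply: (@card_ord_lb _ t); last first.
    by rewrite -(ler_nat R) natrD; apply: ltW; exact: lt_le_trans tl yJ.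
  move=> i /andP[ti itl]; apply/andP; split.
    rewrite ltr_pdivlMr// mulrC (lt_le_trans t2)// ler_nat ltnS//.
  rewrite ltr_pdivrMr// mulrC (le_lt_trans _ tl)// -natrD ler_nat//.
by rewrite /l ltnn.
Qed.

End counting.

Section sublinear.
Variables (R : realType) (n : nat).
Local Notation V := 'rV[R]_n.
Local Notation mu := (lebesgue_outer R n).
Variable e : V -> R.
Hypothesis eP : is_seminorm e.

(** Models the gauge of a possibly asymmetric convex set containing the unit ball of [e];
    [sublin_le] makes it 1-Lipschitz for [e]. *)
Record is_sublinear (p : V -> R) : Prop := {
  sublin_ge0 : forall x, (0 <= p x)%R ;
  sublin_le : forall x, (p x <= e x)%R ;
  sublinD : forall x y, (p (x + y) <= p x + p y)%R ;
  sublinZ : forall a x, (0 < a)%R -> (p (a *: x) = a * p x)%R }.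

Lemma sublin_sub p x y : is_sublinear p -> (p x <= p y + e (x - y))%R.
Proof.
move=> pP; have := sublinD pP y (x - y); rewrite addrC subrK => H.
by apply: (le_trans H); rewrite lerD2l; exact: sublin_le.
Qed.

Lemma sublin_continuous p : is_sublinear p -> continuous p.
Proof.
move=> pP; apply: (@lipschitz_continuous _ _ _ eP _ 1) => x y.
rewrite mul1r ler_norml; apply/andP; split.
  have := sublin_sub y x pP; rewrite (semin_distC eP) => ?; lra.
have := sublin_sub x y pP => ?; lra.
Qed.

(* If z = u + v and z' = u' + v' both minimize p(u) + q(v) over v in s, then
   u/2 + v = u'/2 + v' forces v = v': otherwise, p being convex, swapping v and
   v' would not increase the total cost, so that both would be ties, which
   are broken by taking the first minimizer. *)
Section transport.
Variables (p q : V -> R) (s : seq V).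
Hypotheses (pP : is_sublinear p) (qP : is_sublinear q).
Local Open Scope ring_scope.

Definition split_cost (i : 'I_(size s)) (z : V) : R := p (z - s`_i) + q s`_i.

Definition first_min (i : 'I_(size s)) : set V :=
  [set z | forall j : 'I_(size s), split_cost i z <= split_cost j z /\
    ((j < i)%N -> split_cost i z < split_cost j z)].

Lemma first_min_exists z : (0 < size s)%N -> exists i, first_min i z.
Proof.
move=> s0; pose i0 := Ordinal s0.
pose P := [pred i | [forall j, split_cost i z <= split_cost j z]].
have [i1 _ i1min] := arg_minP (fun i => split_cost i z) (erefl : xpredT i0).
have Pi1 : P i1 by apply/forallP => j; exact: i1min.
have [i /forallP iP imin] := arg_minnP (fun i : 'I_(size s) => i : nat) Pi1.
exists i => j; split => // ji; rewrite ltNge; apply/negP => ij.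
have : P j by apply/forallP => k; exact: le_trans (iP k).
by move=> /imin; rewrite leqNgt ji.
Qed.

Lemma first_min_midpoint (i k : 'I_(size s)) x :
  homothety 2^-1 (2^-1 *: s`_i) (first_min i) x ->
  homothety 2^-1 (2^-1 *: s`_k) (first_min k) x -> i = k.
Proof.
wlog ik : i k / (i < k)%N => [H xi xk|].
  have [lt|lt|/val_inj//] := ltngtP i k; first exact: H.
  by apply/esym/H.
move=> [z zi zx] [z' zmin z'x].
have zz' : z + s`_i = z' + s`_k.
  by apply: (@scalerI _ _ 2^-1); rewrite ?invr_eq0// !scalerDr zx z'x.
(* Swapping the v-parts gives both points the same u-part, the average of the original ones. *)
set m := 2^-1 *: ((z - s`_i) + (z' - s`_k)).
have zk : z - s`_k = m.
  by apply/rowP => j; have := congr1 (fun v : V => v 0 j) zz'; rewrite !mxE => ?; lra.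
have z'i : z' - s`_i = m.
  by apply/rowP => j; have := congr1 (fun v : V => v 0 j) zz'; rewrite !mxE => ?; lra.
(* Minimality of i at z, and strict minimality of k at z' against the earlier i, add up to p(u) +
   p(u') < 2 p(m), contrary to this inequality. *)
have pm : p m <= 2^-1 * (p (z - s`_i) + p (z' - s`_k)).
  by rewrite /m (sublinZ pP)// ler_pM2l//; exact: sublinD.
exfalso; have := (zi k).1; have := (zmin i).2 ik; rewrite /split_cost zk z'i; lra.
Qed.

Lemma first_min_uniq (i k : 'I_(size s)) x : first_min i x -> first_min k x -> i = k.
Proof.
wlog ik : i k / (i < k)%N => [H xi xk|xi xk].
  have [lt|lt|/val_inj//] := ltngtP i k; first exact: H.
  by apply/esym/H.
by have := le_lt_trans (xi k).1 ((xk i).2 ik); rewrite ltxx.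
Qed.

Lemma split_cost_continuous i : continuous (split_cost i).
Proof.
apply: (@lipschitz_continuous _ _ _ eP _ 1) => x y.
have xy : (x - s`_i) - (y - s`_i) = x - y by rewrite opprB addrA subrK.
rewrite mul1r /split_cost ler_norml; apply/andP; split.
  have := sublin_sub (y - s`_i) (x - s`_i) pP.
  by rewrite (semin_distC eP) xy => ?; lra.
have := sublin_sub (x - s`_i) (y - s`_i) pP; rewrite xy => ?; lra.
Qed.

Lemma measurable_le_fun (f g : V -> R) : continuous f -> continuous g ->
  mu.-caratheodory [set x | f x <= g x].
Proof.
move=> cf cg; have -> : [set x | f x <= g x] = [set x | f x - g x <= 0].
  by apply/seteqP; split => x /=; rewrite subr_le0.
by apply: measurable_le => x; exact: (continuousB (cf x) (cg x)).
Qed.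

Lemma measurable_lt_fun (f g : V -> R) : continuous f -> continuous g ->
  mu.-caratheodory [set x | f x < g x].
Proof.
move=> cf cg; have -> : [set x | f x < g x] = [set x | f x - g x < 0].
  by apply/seteqP; split => x /=; rewrite subr_lt0.
by apply: measurable_lt => x; exact: (continuousB (cf x) (cg x)).
Qed.

Lemma measurable_first_min i : mu.-caratheodory (first_min i).
Proof.
have -> : first_min i = \bigcap_(j in [set: 'I_(size s)])
    ([set z | split_cost i z <= split_cost j z] `&`
     (if (j < i)%N then [set z | split_cost i z < split_cost j z] else setT)).
  apply/seteqP; split => [z zi j _|z zi j].
    by split; [exact: (zi j).1|case: ifPn => // /(zi j).2].
  by have [le] := zi j I; case: ifPn.
apply: (@fin_bigcap_measurable _ (caratheodory_type mu)) => [|j _].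
  exact: finite_finset.
apply: measurableI; first by apply: measurable_le_fun; exact: split_cost_continuous.
case: ifPn => _; last exact: measurableT.
by apply: measurable_lt_fun; exact: split_cost_continuous.
Qed.

End transport.

Section core.
Variables (p q : V -> R) (G : set V) (r : nat).
Hypotheses (pP : is_sublinear p) (qP : is_sublinear q).
Hypotheses (e_gt0 : 0 < mu (eball e 1)) (e_fin : mu (eball e 1) < +oo).
Hypothesis GP : forall z, G z -> (e z < r%:R)%R /\ (1 <= q z <= p z)%R /\
  exists u v, z = (u + v)%R /\ (p u + q v <= 1)%R /\ (e v < r%:R)%R.

Let Delta : set V := [set x | q x < 1 /\ 1 < p x]%R.

Lemma scaled_Delta (t : R) : (0 < t)%R ->
  homothety t 0 Delta = [set x | q x < t /\ t < p x]%R.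
Proof.
move=> t0; rewrite homothetyE//; apply/seteqP; split => x /=;
  rewrite /Delta/= subr0 !sublinZ ?invr_gt0// ltr_pdivrMl// ltr_pdivlMl// mulr1;
  by case.
Qed.

Lemma measurable_Delta (t : R) : mu.-caratheodory [set x | q x < t /\ t < p x]%R.
Proof.
apply: (@measurableI _ (caratheodory_type mu)).
  by apply: measurable_lt; exact: sublin_continuous.
by apply: measurable_gt; exact: sublin_continuous.
Qed.

Lemma eball_fin (t : R) : (0 < t)%R -> mu (eball e t) < +oo.
Proof.
by move=> t0; rewrite mu_eball// lte_mul_pinfty// lee_fin exprn_ge0// ltW.
Qed.

(** N dilates of [G] are compared with the dilates of [Delta] at the levels (j+1)/N <= 2r. A point
    lying in many of the former has an image lying in many of the latter; the bounded mismatch at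
    each point costs the last term, which does not grow with N. *)
Lemma core_discrete (N : nat) : (0 < N)%N -> (0 < r)%N ->
  N%:R%:E * mu G <= (2 * (2 * r * N)%:R * 2 ^+ n * (2 * r)%:R ^+ n)%R%:E * mu Delta +
                    4%:E * mu (eball e (2 * r)%:R).
Proof.
move=> N0 r0.
have Nr : (0 < N%:R :> R)%R by rewrite ltr0n.
have r2 : (0 < (2 * r)%:R :> R)%R by rewrite ltr0n muln_gt0.
set D := eball e (2 * r)%:R.
(* A net of mesh 1/(2N): rounding v to it raises p(u) + q(v) by at most 1/N. *)
have [s [sD sP _]] : exists s : seq V, [/\ forall a, a \in s -> D a,
    forall v, D v -> exists2 a, a \in s & (e (v - a) < 2 * (4 * N%:R)^-1)%R &
    (size s)%:R%:E * mu (eball e (4 * N%:R)^-1%R) <= mu (eball e ((2 * r)%:R + 1))].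
  apply: packing => //; first by rewrite invr_gt0 mulr_gt0.
    by apply: eball_fin; lra.
  move=> a y Da yN; rewrite /eball/=; apply: (le_lt_trans (semin_leD eP _ _)).
  apply: ltrD => //; apply: (lt_le_trans yN); rewrite invf_le1; last lra.
  have : (1 <= N%:R :> R)%R by rewrite ler1n.
  by move=> ?; lra.
pose tau (k : 'I_N) : R := ((N + k)%:R / N%:R)%R.
have tau1 k : (1 <= tau k)%R.
  by rewrite /tau ler_pdivlMr// mul1r ler_nat leq_addr.
have tau2 k : (tau k < 2)%R.
  by rewrite /tau ltr_pdivrMr// -natrM ltr_nat mul2n -addnn ltn_add2l.
(* These levels reach 2r, which bounds e, hence p, at the image points [T i z]. *)
pose J := (2 * r * N)%N.
(* With v = s_i and u = z - v this is u/2 + v. *)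
pose T (i : 'I_(size s)) (z : V) : V := (2^-1 *: z + 2^-1 *: s`_i)%R.
pose Di (i : 'I_(size s)) := D `&` (first_min p q i `&` [set z | q z <= p z]%R).
pose A k i := Di i `&` [set z | split_cost p q i z <= tau k + N%:R^-1 /\ tau k <= q z]%R.
pose Dj (j : 'I_J) := [set x | q x < j.+1%:R / N%:R /\ j.+1%:R / N%:R < p x]%R.
pose B i j := Di i `&` [set z | Dj j (T i z)].
have mDi i : mu.-caratheodory (Di i).
  apply: (@measurableI _ (caratheodory_type mu)); first exact: measurable_eball.
  apply: (@measurableI _ (caratheodory_type mu)); first exact: measurable_first_min.
  by apply: measurable_le_fun; exact: sublin_continuous.
have mA k i : mu.-caratheodory (A k i).
  apply: (@measurableI _ (caratheodory_type mu)); first exact: mDi.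
  apply: (@measurableI _ (caratheodory_type mu)).
    by apply: measurable_le; exact: split_cost_continuous.
  by apply: measurable_ge; exact: sublin_continuous.
have mB i j : mu.-caratheodory (B i j).
  apply: (@measurableI _ (caratheodory_type mu)); first exact: mDi.
  rewrite (_ : [set z | _] = homothety 2 (- s`_i) (Dj j)).
    by apply: measurable_homothety => //; exact: measurable_Delta.
  by rewrite homothetyE//; apply/seteqP; split => z; rewrite /T/= opprK scalerDr.
have step1 : N%:R%:E * mu G <= \sum_(k < N) mu (homothety (tau k) 0 G).
  rewrite -sum_const_ereal ?outer_measure_ge0//; apply: lee_sum => k _.
  rewrite mu_homothety; last exact: lt_le_trans (tau1 k).
  by rewrite -[leLHS]mul1e lee_wpmul2r ?outer_measure_ge0// lee_fin exprn_ege1.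
have step2 k : mu (homothety (tau k) 0 G) <= \sum_(i < size s) mu (A k i).
  apply: mu_le_sum => _ [z Gz <-]; rewrite addr0.
  have t0 : (0 < tau k)%R by exact: lt_le_trans (tau1 k).
  have [ez [/andP[q1 qp] [u [v [zuv [puv ev]]]]]] := GP Gz.
  have scale_lt x : (e x < r%:R)%R -> D (tau k *: x)%R.
    move=> xr; rewrite /D /eball/= (seminZ eP) gtr0_norm// natrM.
    by apply: ltr_pM => //; [exact: ltW|exact: semin_ge0].
  have [a sa va] := sP _ (scale_lt _ ev).
  have [i imin] := first_min_exists p q (tau k *: z)%R
    (leq_ltn_trans (leq0n _) ltac:(by rewrite -index_mem in sa; exact: sa)).
  exists i; first by rewrite mem_index_enum.
  split; first split; first exact: scale_lt.
    by split => //=; rewrite !sublinZ// ler_pM2l.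
  split; last by rewrite sublinZ// ler_peMr// ltW.
  have ai : (index a s < size s)%N by rewrite index_mem.
  apply: (le_trans (imin (Ordinal ai)).1); rewrite /split_cost/= nth_index//.
  have pa := sublin_sub (tau k *: z - a) (tau k *: u) pP.
  have qa := sublin_sub a (tau k *: v) qP.
  rewrite !sublinZ// (semin_distC eP a) in pa qa.
  have zav : (tau k *: z - a - tau k *: u = tau k *: v - a)%R.
    by rewrite zuv scalerDr addrAC [X in (X - a)%R]addrAC subrr add0r.
  rewrite zav in pa.
  have : (tau k * (p u + q v) <= tau k)%R by rewrite ler_piMr// ltW.
  rewrite invfM in va.
  set d := (N%:R^-1)%R in va *; move=> ?; lra.
have step3 i : \sum_(k < N) mu (A k i) <=
    2%:R%:E * \sum_(j < J) mu (B i j) + 4%:R%:E * mu (Di i).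
  apply: (@count_measure_le _ (caratheodory_type mu)).
  - exact: mDi.
  - by move=> k; exact: mA.
  - by move=> j; exact: mB.
  - by move=> k z [].
  - by move=> j z [].
  move=> z zD; have [Dz [zi qp]] := zD.
  have h1 (k : 'I_N) : (z \in A k i) = ((split_cost p q i z <=
      (N + k)%:R / N%:R + N%:R^-1) && ((N + k)%:R / N%:R <= q z))%R.
    by apply/idP/andP => [/set_mem[_ []]//|[? ?]]; apply/mem_set; split.
  have h2 (j : 'I_J) : (z \in B i j) = ((q (T i z) < j.+1%:R / N%:R) &&
      (j.+1%:R / N%:R < p (T i z)))%R.
    by apply/idP/andP => [/set_mem[_ []]//|[? ?]]; apply/mem_set; split.
  under eq_bigr do rewrite h1.
  under [in leqRHS]eq_bigr do rewrite h2.
  apply: count_compare => //; first exact: sublin_ge0.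
    have eT : (e (T i z) <= (2 * r)%:R)%R.
      apply: (le_trans (semin_leD eP _ _)); rewrite !(seminZ eP) ger0_norm//.
      have si : (e s`_i < (2 * r)%:R)%R by apply: sD; rewrite mem_nth.
      have zr : (e z < (2 * r)%:R)%R := Dz.
      by move: ((2 * r)%:R)%R si zr => x ? ?; lra.
    rewrite /J natrM mulrC ler_wpM2r//.
    by apply: le_trans eT; exact: sublin_le.
  (* Together with [qT] this gives 2 (p - q)(T z) >= 2 p(z) - q(z) - cost, which is at least q(z) -
     cost because q <= p at z. *)
  have pz : (p z <= p (T i z) + 2^-1 * p (z - s`_i))%R.
    rewrite -(sublinZ pP)//; apply: le_trans (sublinD pP _ _).
    rewrite le_eqVlt; apply/orP; left; apply/eqP; congr p.
    by apply/rowP => j; rewrite !mxE; lra.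
  have qT : (q (T i z) <= 2^-1 * q z + 2^-1 * q s`_i)%R.
    by rewrite -!(sublinZ qP)//; exact: sublinD.
  rewrite /split_cost; move: qp => /= ?; lra.
(* At a fixed level the images of the cells are disjoint by [first_min_midpoint] and lie in one
   dilate of [Delta], of ratio at most 2r. *)
have step4 j : \sum_(i < size s) mu (B i j) <= (2 ^+ n * (2 * r)%:R ^+ n)%:E * mu Delta.
  have h2 : (0 < 2^-1 :> R)%R by [].
  have -> : \sum_(i < size s) mu (B i j) =
      (2 ^+ n)%:E * \sum_(i < size s) mu (homothety 2^-1 (2^-1 *: s`_i) (B i j)).
    rewrite ge0_sume_distrr => [|i _]; last exact: outer_measure_ge0.
    apply: eq_bigr => i _; rewrite mu_homothety// muleA -EFinM -exprMn divff//.
    by rewrite expr1n mul1e.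
  rewrite EFinM -muleA lee_wpmul2l ?lee_fin ?exprn_ge0//.
  apply: (@le_trans _ _ (mu (Dj j))).
    apply: sum_disjoint_le => [i|i k x|i].
    - by apply: measurable_homothety.
    - move=> [z [[_ [zi _]] _] zx] [z' [[_ [z'k _]] _] z'x].
      apply: (first_min_midpoint pP (x := x)); first by exists z.
      by exists z'.
    - by move=> _ [z [_ Bz] <-].
  have t0 : (0 < j.+1%:R / N%:R :> R)%R by rewrite divr_gt0.
  rewrite /Dj -scaled_Delta// mu_homothety// lee_wpmul2r ?outer_measure_ge0//.
  have t1 : (j.+1%:R / N%:R <= (2 * r)%:R :> R)%R.
    by rewrite ler_pdivrMr// -natrM ler_nat.
  by rewrite lee_fin lerXn2r// nnegrE ltW.
have step5 : \sum_(i < size s) mu (Di i) <= mu D.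
  apply: sum_disjoint_le => // [i k x [_ [xi _]] [_ [xk _]]|i x []//].
  exact: first_min_uniq xi xk.
apply: (le_trans step1); apply: (le_trans (lee_sum _ (fun k _ => step2 k))).
rewrite exchange_big/=; apply: (le_trans (lee_sum _ (fun i _ => step3 i))).
rewrite big_split/=; apply: leeD.
  rewrite -ge0_sume_distrr; last first.
    by move=> i _; apply: sume_ge0 => j _; exact: (outer_measure_ge0 mu).
  rewrite exchange_big/= -/J -!mulrA EFinM -muleA lee_wpmul2l//.
  apply: (le_trans (lee_sum _ (fun j _ => step4 j))).
  rewrite sum_const_ereal; first by rewrite muleA -EFinM.
  by rewrite mule_ge0 ?outer_measure_ge0// lee_fin mulr_ge0// exprn_ge0.
rewrite -ge0_sume_distrr ?lee_wpmul2l// => i _.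
exact: (outer_measure_ge0 mu).
Qed.

End core.

End sublinear.

Section gap.
Variables (R : realType) (n : nat).
Local Notation V := 'rV[R]_n.
Local Notation mu := (lebesgue_outer R n).
Variable e : V -> R.
Hypothesis eP : is_seminorm e.
Hypotheses (e_gt0 : 0 < mu (eball e 1)) (e_fin : mu (eball e 1) < +oo).

Lemma le_of_natmul (g d c : R) :
  (forall N : nat, (0 < N)%N -> N%:R * g <= N%:R * d + c)%R -> (g <= d)%R.
Proof.
move=> H; rewrite leNgt; apply/negP => dg.
have gd : (0 < g - d)%R by rewrite subr_gt0.
pose N := (Num.trunc (`|c| / (g - d))).+1.
have : (`|c| / (g - d) < N%:R)%R by exact: truncnS_gt.
rewrite ltr_pdivrMr// mulrBr => cN.
have := H N isT; have := ler_norm c; lra.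
Qed.

(** Divide [core_discrete] by N and let N grow: its ball term is independent of N. *)
Lemma gap_le (p q : V -> R) (G : set V) (r : nat) :
  is_sublinear e p -> is_sublinear e q -> (0 < r)%N ->
  (forall z, G z -> (e z < r%:R)%R /\ (1 <= q z <= p z)%R /\
    exists u v, z = (u + v)%R /\ (p u + q v <= 1)%R /\ (e v < r%:R)%R) ->
  mu G <= (4 * r%:R * 2 ^+ n * (2 * r)%:R ^+ n)%R%:E *
    mu [set x | q x < 1 /\ 1 < p x]%R.
Proof.
move=> pP qP r0 GP; set C := (X in X%:E * _); set Delta := (X in _ * mu X).
have Cgt0 : (0 < C)%R by rewrite !mulr_gt0 ?exprn_gt0 ?ltr0n ?muln_gt0.
have core N N0 := @core_discrete _ _ e eP p q G r pP qP e_gt0 e_fin GP N N0 r0.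
rewrite -/Delta in core; set D := eball e _ in core.
have Dfin : mu D < +oo by apply: eball_fin => //; rewrite ltr0n muln_gt0.
have [->|Doo] := eqVneq (mu Delta) +oo; first by rewrite gt0_muley ?lte_fin// leey.
have [d dE] : exists x, mu Delta = x%:E by apply: mu_fin_real; rewrite ltey.
have [c cE] := mu_fin_real Dfin.
have [g gE] : exists x, mu G = x%:E.
  apply: mu_fin_real; have := core 1%N isT; rewrite mul1e => H; apply: (le_lt_trans H).
  by rewrite dE cE -!EFinM -EFinD ltry.
rewrite gE dE -EFinM lee_fin; apply: (@le_of_natmul _ _ (4 * c)) => N N0.
have := core N N0; rewrite gE dE cE -!EFinM -EFinD lee_fin => H.
apply: (le_trans H); rewrite lerD2r /C !natrM le_eqVlt; apply/orP; left; apply/eqP.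
by ring.
Qed.

Section gauge.
Variable X : set V.
Hypotheses (cX : convex_set X) (eX : eball e 1 `<=` X).
Local Open Scope ring_scope.

Let S x : set R := [set t | 0 < t /\ X (t^-1 *: x)].

(** The Minkowski functional. As [X] may be neither open nor closed, gauge 1 does not decide
    membership; gauge below 1 implies it and gauge above 1 excludes it. *)
Definition gauge (x : V) : R := inf (S x).

Let X0 : X 0. Proof. by apply: eX; rewrite /eball/= (semin0 eP). Qed.

Let S_up x t t' : S x t -> t <= t' -> S x t'.
Proof.
move=> [t0 Xt] tt'; have t'0 := lt_le_trans t0 tt'; split => //.
have -> : t'^-1 *: x = (t / t') *: (t^-1 *: x) + (1 - t / t') *: 0.
  by rewrite scaler0 addr0 scalerA mulrAC divff ?gt_eqF// mul1r.
move/convex_setP : cX; apply => //.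
- by rewrite divr_ge0// ltW.
- by rewrite subr_ge0 ler_pdivrMr// mul1r.
- by rewrite addrC subrK.
Qed.

Let S_e x t : e x < t -> S x t.
Proof.
move=> ext; have t0 : 0 < t by apply: le_lt_trans ext; exact: semin_ge0.
split => //; apply: eX; rewrite /eball/= (seminZ eP) gtr0_norm ?invr_gt0//.
by rewrite ltr_pdivrMl// mulr1.
Qed.

Let S_inf x : has_inf (S x).
Proof.
split; first by exists (e x + 1); apply: S_e; rewrite ltrDl.
by exists 0 => t [/ltW].
Qed.

Lemma gauge_le x t : 0 < t -> X (t^-1 *: x) -> gauge x <= t.
Proof. by move=> t0 Xt; apply: ge_inf; [exact: (S_inf x).2|split]. Qed.

Lemma gauge_lt x t : gauge x < t -> 0 < t /\ X (t^-1 *: x).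
Proof.
move=> /(inf_lt (S_inf x).1)[s Ss st]; exact: S_up Ss (ltW st).
Qed.

Lemma gauge_ge0 x : 0 <= gauge x.
Proof.
by apply: lb_le_inf; [exact: (S_inf x).1|move=> t [/ltW]].
Qed.

Lemma gauge_sublinear : is_sublinear e gauge.
Proof.
have leZ a x : 0 < a -> gauge (a *: x) <= a * gauge x.
  move=> a0; apply/ler_addgt0Pr => d d0.
  have /gauge_lt[t0 Xt] : gauge x < gauge x + d / a by rewrite ltrDl divr_gt0.
  have -> : a * gauge x + d = a * (gauge x + d / a).
    by rewrite mulrDr mulrCA divff ?mulr1// gt_eqF.
  apply: gauge_le; first by rewrite mulr_gt0.
  by rewrite invfM scalerA mulrAC mulVf ?mul1r// gt_eqF.
split; first exact: gauge_ge0.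
- move=> x; apply/ler_addgt0Pr => d d0.
  by have [? ?] := @S_e x (e x + d) ltac:(by rewrite ltrDl); exact: gauge_le.
- move=> x y; apply/ler_addgt0Pr => d d0.
  have d2 : 0 < d / 2 by rewrite divr_gt0.
  have /gauge_lt[s0 Xs] : gauge x < gauge x + d / 2 by rewrite ltrDl.
  have /gauge_lt[t0 Xt] : gauge y < gauge y + d / 2 by rewrite ltrDl.
  set s := gauge x + d / 2 in s0 Xs *; set t := gauge y + d / 2 in t0 Xt *.
  have -> : gauge x + gauge y + d = s + t by rewrite /s /t; lra.
  apply: gauge_le; first exact: addr_gt0.
  have [z Xz zE] := convex_cone cX Xs Xt (ltW s0) (ltW t0).
  rewrite !scalerA !divff ?gt_eqF// !scale1r in zE.
  by rewrite zE scalerA mulVf ?scale1r// gt_eqF// addr_gt0.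
- move=> a x a0; apply/eqP; rewrite eq_le leZ//=.
  rewrite -ler_pdivlMl//.
  have {1}-> : x = a^-1 *: (a *: x) by rewrite scalerA mulVf ?scale1r// gt_eqF.
  by apply: leZ; rewrite invr_gt0.
Qed.

Lemma gauge_lt1 x : gauge x < 1 -> X x.
Proof. by move=> /gauge_lt[_]; rewrite invr1 scale1r. Qed.

Lemma gauge_le_scale x a : X x -> 0 <= a -> gauge (a *: x) <= a.
Proof.
move=> Xx; rewrite le_eqVlt => /predU1P[<-|a0].
  by rewrite scale0r -(semin0 eP); exact: (sublin_le gauge_sublinear).
by apply: gauge_le => //; rewrite scalerA mulVf ?scale1r// gt_eqF.
Qed.

End gauge.

(** Beyond X ∩ Y and X Δ Y the hull has only the gap, which is halved according to the larger gauge.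
    Each half costs C |X Δ Y|, whence 1 + 2C. *)
Lemma mu_hull_le_near (X Y : set V) (r : nat) :
  convex_set X -> convex_set Y -> eball e 1 `<=` X -> eball e 1 `<=` Y ->
  (forall x, X x -> e x < r%:R)%R -> (forall y, Y y -> e y < r%:R)%R ->
  mu (convex_hull (X `|` Y)) <= mu (X `&` Y) +
    (1 + 2 * (4 * r%:R * 2 ^+ n * (2 * r)%:R ^+ n))%R%:E * mu (X `+` Y).
Proof.
move=> cX cY eX eY Xr Yr.
have e00 : eball e 1 0%R by rewrite /eball/= (semin0 eP).
have r0 : (0 < r)%N.
  by have := Xr 0%R (eX _ e00); rewrite (semin0 eP) ltr0n.
set C := (4 * _ * _ * _)%R.
have C0 : (0 <= C)%R by rewrite !mulr_ge0.
set L := convex_hull _.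
pose p := gauge X; pose q := gauge Y.
have pP : is_sublinear e p := gauge_sublinear cX eX.
have qP : is_sublinear e q := gauge_sublinear cY eY.
pose G1 : set V := [set z | (L z /\ ~ X z /\ ~ Y z) /\ (q z <= p z)%R].
pose G2 : set V := [set z | (L z /\ ~ X z /\ ~ Y z) /\ (p z <= q z)%R].
have LP z : L z -> ~ X z -> ~ Y z ->
    [/\ (e z < r%:R)%R, (1 <= p z)%R, (1 <= q z)%R & exists u v, z = (u + v)%R /\
      (p u + q v <= 1)%R /\ (e u < r%:R)%R /\ (e v < r%:R)%R].
  move=> Lz nX nY.
  have [x [y [a [b [Xx Yy a0 b0 [ab zE]]]]]] :=
    convex_hullU cX cY (eX _ e00) (eY _ e00) Lz.
  have ex := Xr _ Xx; have ey := Yr _ Yy.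
  have ex0 := semin_ge0 eP x; have ey0 := semin_ge0 eP y.
  split.
  - rewrite zE; apply: (le_lt_trans (semin_leD eP _ _)).
    rewrite !(seminZ eP) !ger0_norm//.
    have bE : b = (1 - a)%R by lra.
    have [xy|/ltW yx] := leP (e x) (e y).
      by have := ler_wpM2l a0 xy; rewrite bE => ?; lra.
    by have := ler_wpM2l b0 yx; rewrite bE => ?; lra.
  - by rewrite leNgt; apply/negP => /(gauge_lt1 cX eX).
  - by rewrite leNgt; apply/negP => /(gauge_lt1 cY eY).
  - exists (a *: x)%R, (b *: y)%R; split => //; split.
      have := gauge_le_scale cX eX Xx a0; have := gauge_le_scale cY eY Yy b0.
      by rewrite -/p -/q => ? ?; lra.
    split; rewrite (seminZ eP) ger0_norm//.
      by apply: le_lt_trans ex; rewrite ler_piMl// -ab lerDl.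
    by apply: le_lt_trans ey; rewrite ler_piMl// -ab lerDr.
have XYsub : [set x | q x < 1 /\ 1 < p x]%R `<=` X `+` Y.
  move=> x /= [qx px]; right; split; first exact: (gauge_lt1 cY eY).
  move=> Xx; have := gauge_le_scale cX eX Xx ler01; rewrite scale1r -/p; lra.
have YXsub : [set x | p x < 1 /\ 1 < q x]%R `<=` X `+` Y.
  move=> x /= [px qx]; left; split; first exact: (gauge_lt1 cX eX).
  move=> Yx; have := gauge_le_scale cY eY Yx ler01; rewrite scale1r -/q; lra.
have G1le : mu G1 <= C%:E * mu (X `+` Y).
  apply: (@le_trans _ _ (C%:E * mu [set x | q x < 1 /\ 1 < p x]%R)).
    apply: gap_le => // z [[Lz [nX nY]] qp].
    have [ez p1 q1 [u [v [zE [uv [eu ev]]]]]] := LP z Lz nX nY.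
    by split => //; split; [rewrite q1|exists u, v].
  by rewrite lee_wpmul2l//; exact: le_outer_measure.
have G2le : mu G2 <= C%:E * mu (X `+` Y).
  apply: (@le_trans _ _ (C%:E * mu [set x | p x < 1 /\ 1 < q x]%R)).
    apply: gap_le => // z [[Lz [nX nY]] qp].
    have [ez p1 q1 [u [v [zE [uv [eu ev]]]]]] := LP z Lz nX nY.
    split => //; split; first by rewrite p1.
    by exists v, u; rewrite addrC (addrC (q v)).
  by rewrite lee_wpmul2l//; exact: le_outer_measure.
have : L `<=` ((X `&` Y) `|` (X `+` Y)) `|` (G1 `|` G2).
  move=> z Lz; have [Xz|nX] := pselect (X z); have [Yz|nY] := pselect (Y z).
  - by left; left.
  - by left; right; left.
  - by left; right; right.
  - by have [le|/ltW le] := leP (q z) (p z); right; [left|right].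
move=> /(le_outer_measure mu); move=> H; apply: (le_trans H).
apply: (le_trans (outer_measureU2 _ _ _)).
apply: (le_trans (leeD (outer_measureU2 _ _ _) (outer_measureU2 _ _ _))).
rewrite -addeA; apply: leeD => //.
apply: (le_trans (leeD (lexx _) (leeD G1le G2le))).
rewrite EFinD ge0_muleDl ?lee_fin ?mulr_ge0// mul1e; apply: leeD => //.
by rewrite -ge0_muleDl ?lee_fin// -EFinD mulr_natl mulr2n.
Qed.

End gap.

(** * A well-conditioned norm *)

Section matrix_seminorm.
Variables (R : realType) (n : nat).
Local Notation V := 'rV[R]_n.
Local Notation mu := (lebesgue_outer R n).
Local Open Scope ring_scope.

(** Covers the sup norm ([W] the identity), the absolute value of a linear form ([W] a column) and
    the coordinates of a simplex ([W] a scaled inverse). *)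
Definition mxseminorm (m : nat) (W : 'M[R]_(n, m)) (x : V) : R := `|x *m W|.

Lemma mxseminormP m (W : 'M[R]_(n, m)) : is_seminorm (mxseminorm W).
Proof.
split.
- by move=> x y; rewrite /mxseminorm mulmxDl ler_normD.
- move=> a x; rewrite /mxseminorm -scalemxAl; exact: normrZ.
- pose M := \sum_i \sum_j `|W i j|; exists (M + 1) => x.
  have M0 : 0 <= M by apply: sumr_ge0 => i _; apply: sumr_ge0.
  have M1 : 0 <= (M + 1) * `|x| by rewrite mulr_ge0 ?addr_ge0.
  suff H j : `|(x *m W) ord0 j| <= (M + 1) * `|x|.
    rewrite /mxseminorm [in leLHS]/Num.Def.normr/= mx_normrE.
    by apply/bigmax_leP; split => // -[i j] _ /=; rewrite (ord1 i).
  rewrite mxE; apply: (le_trans (ler_norm_sum _ _ _)).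
  apply: (@le_trans _ _ (M * `|x|)); last by rewrite ler_wpM2r// lerDl.
  rewrite /M mulr_suml; apply: ler_sum => i _; rewrite normrM mulrC.
  apply: ler_pM => //; last exact: mx_norm_ler_coord.
  by rewrite (bigD1 j)//= lerDl; apply: sumr_ge0.
Qed.

(** Countably many dilates of the unit ball cover the space, so a null ball would make every set
    null. *)
Lemma mu_ball_gt0 (e : V -> R) (A : set V) : is_seminorm e ->
  (0 < mu A -> 0 < mu (eball e 1))%E.
Proof.
move=> eP A0; rewrite lt_neqAle outer_measure_ge0 andbT; apply/eqP => /esym e0.
have : (mu A <= mu (\bigcup_k eball e k.+1%:R))%E.
  apply: le_outer_measure => x _; exists (Num.trunc (e x)) => //=.
  exact: truncnS_gt.
rewrite leNgt => /negP; apply; apply: le_lt_trans A0.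
apply: (le_trans (outer_measure_sigma_subadditive mu _)).
by rewrite eseries0// => k _ _; rewrite mu_eball// e0 mule0.
Qed.

(** For every N, N translates of a bounded piece along a transversal direction are disjoint inside
    one fixed ball. *)
Lemma mu_hyperplane (a : 'cV[R]_n) (v0 : V) : a != 0 ->
  mu [set x | (x - v0) *m a = 0] = 0%E.
Proof.
move=> /cV0Pn[i0 ai0].
pose w : V := delta_mx 0 i0.
have wa : (w *m a) 0 0 = a i0 0.
  by rewrite -rowE mxE.
pose H (m : nat) := [set x | (x - v0) *m a = 0] `&` eball (mxseminorm 1%:M) m%:R.
have normE x : mxseminorm 1%:M x = `|x| by rewrite /mxseminorm mulmx1.
have mH m : mu.-caratheodory (H m).
  apply: (@measurableI _ (caratheodory_type mu)); last first.
    exact/measurable_eball/mxseminormP.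
  have -> : [set x | (x - v0) *m a = 0] = [set x | mxseminorm a (x - v0) <= 0].
    apply/seteqP; split => x /=; first by rewrite /mxseminorm => ->; rewrite normr0.
    by rewrite /mxseminorm normr_le0 => /eqP.
  apply: measurable_le; apply: (lipschitz_continuous (mxseminormP a) (M := 1)) => x y.
  rewrite mul1r /mxseminorm.
  have -> : (x - y) *m a = (x - v0) *m a - (y - v0) *m a.
    by rewrite -mulmxBl opprB addrA subrK.
  exact: ler_dist_dist.
have H0 m : mu (H m) = 0%E.
  pose B := eball (mxseminorm 1%:M) (m%:R + `|w|).
  have Boo : (mu B < +oo)%E.
    by apply: (@lebesgue_rV_bounded _ _ _ (m%:R + `|w|)) => x; rewrite /B /eball/= normE => /ltW.
  have NH (N : nat) : (N%:R%:E * mu (H m) <= mu B)%E.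
    rewrite -sum_const_ereal ?outer_measure_ge0//.
    pose F (k : 'I_N) := homothety 1 ((k%:R / N%:R) *: w) (H m).
    have -> : (\sum_(k < N) mu (H m) = \sum_(k < N) mu (F k))%E.
      by apply: eq_bigr => k _; rewrite /F mu_homothety// expr1n mul1e.
    have h1 : 0 < 1 :> R by [].
    apply: sum_disjoint_le => [k|k l _ [x [xH _] <-] [y [yH _]]|k _ [x [_ xm] <-]].
    - exact: measurable_homothety.
    - rewrite !scale1r => yx.
      have N0 : 0 < N%:R :> R by rewrite ltr0n; exact: leq_ltn_trans (ltn_ord k).
      have : (x - v0) *m a + ((k%:R / N%:R) *: w) *m a =
             (y - v0) *m a + ((l%:R / N%:R) *: w) *m a.
        by rewrite -!mulmxDl ![_ - v0 + _]addrAC yx.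
      rewrite (xH : _ = _) (yH : _ = _) !add0r -!scalemxAl => /matrixP/(_ 0 0).
      rewrite !mxE -/(mulmx _ _) => /eqP.
      have := wa; rewrite mxE => ->.
      rewrite -subr_eq0 -mulrBl mulf_eq0 (negbTE ai0) orbF subr_eq0.
      have Ni : N%:R^-1 != 0 :> R by rewrite invr_eq0 gt_eqF.
      move=> /eqP /(mulIf Ni) /eqP; rewrite eqr_nat => /eqP kl.
      exact/val_inj.
    - rewrite /B /eball/= normE scale1r; apply: (le_lt_trans (ler_normD _ _)).
      apply: ltr_leD; first by move: xm; rewrite /eball/= normE.
      rewrite normrZ ger0_norm ?divr_ge0// ler_piMl//.
      have N0 : 0 < N%:R :> R by rewrite ltr0n; exact: leq_ltn_trans (ltn_ord k).
      by rewrite ler_pdivrMr// mul1r ler_nat ltnW.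
  have Bfin : mu B \is a fin_num by rewrite ge0_fin_numE ?outer_measure_ge0.
  have Hfin : mu (H m) \is a fin_num.
    rewrite ge0_fin_numE ?outer_measure_ge0//; apply: le_lt_trans Boo.
    by have := NH 1%N; rewrite mul1e.
  have h0 : 0 <= fine (mu (H m)) by rewrite fine_ge0 ?outer_measure_ge0.
  rewrite -(fineK Hfin); congr EFin; apply/eqP; rewrite eq_le h0 andbT.
  apply: (@le_of_natmul _ _ _ (fine (mu B))) => N _.
  by rewrite mulr0 add0r -lee_fin EFinM (fineK Hfin) (fineK Bfin).
apply/eqP; rewrite eq_le outer_measure_ge0 andbT.
have : [set x | (x - v0) *m a = 0] `<=` \bigcup_m H m.
  move=> x xa; exists (Num.trunc `|x|).+1 => //; split => //.
  by rewrite /eball/= normE truncnS_gt.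
move=> /(le_outer_measure mu) le; apply: (le_trans le).
apply: (le_trans (outer_measure_sigma_subadditive mu _)).
by rewrite eseries0.
Qed.

(** Rows are added one at a time: a set of positive measure lies in no hyperplane, so it leaves the
    affine span of fewer than n edges at [v0]. *)
Lemma exists_free_rows (K : set V) (v0 : V) : (0 < mu K)%E ->
  exists2 M : 'M[R]_n, M \in unitmx & forall i, K (v0 + row i M).
Proof.
move=> K0.
suff H k : (k <= n)%N -> exists2 M : 'M[R]_(k, n), row_free M &
    forall i, K (v0 + row i M).
  by have [M fM KM] := H n (leqnn n); exists M; rewrite -?row_free_unit.
elim: k => [|k IH] kn.
  exists 0 => [|[]//]; by rewrite /row_free mxrank0.
have [M /eqP rM KM] := IH (ltnW kn).
have [x Kx xM] : exists2 x, K x & ~~ (x - v0 <= M)%MS.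
  apply: contrapT => noX.
  have : cokermx M != 0 by rewrite -mxrank_eq0 mxrank_coker rM subn_eq0 -ltnNge.
  move=> /matrix0Pn[i [j Mij]].
  have aj : col j (cokermx M) != 0 by apply/cV0Pn; exists i; rewrite mxE.
  have : (mu K <= mu [set x | (x - v0) *m col j (cokermx M) = 0]%R)%E.
    apply: le_outer_measure => x Kx /=.
    have : (x - v0 <= M)%MS by apply: contrapT => /negP xM; apply: noX; exists x.
    by rewrite submxE => /eqP xM; rewrite colE mulmxA xM mul0mx.
  by rewrite mu_hyperplane// leNgt K0.
rewrite -addn1; exists (col_mx M (x - v0)).
  rewrite /row_free eqn_leq rank_leq_row -addsmxE addn1 -{1}rM rank_ltmx//.
  by rewrite ltmxE addsmxSl addsmx_sub submx_refl (negbTE xM).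
move=> i; case: (split_ordP i) => j ->.
  by rewrite rowKu.
by rewrite rowKd row_id addrC subrK.
Qed.

End matrix_seminorm.

(** * Simplices of nearly maximal volume *)

Section john.
Variables (R : realType) (n : nat).
Local Notation V := 'rV[R]_n.
Local Notation mu := (lebesgue_outer R n).
Local Open Scope ring_scope.

Lemma convex_cone_sum (X : set V) (v0 : V) (m : nat) (r : 'I_m -> V) (t : 'I_m -> R) :
  convex_set X -> X v0 -> (forall i, X (v0 + r i)) -> (forall i, 0 <= t i) ->
  exists2 z, X (v0 + z) & \sum_i t i *: r i = (\sum_i t i) *: z.
Proof.
move=> cX Xv0; elim: m r t => [|m IH] r t Xr t0.
  by exists 0; rewrite ?addr0// !big_ord0 scaler0.
have [//|//|z Xz zE] := IH (r \o lift ord0) (t \o lift ord0).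
  by move=> i; exact: Xr.
  by move=> i; exact: t0.
rewrite !big_ord_recl /= in zE *.
have S0 : 0 <= \sum_(i < m) t (lift ord0 i) by apply: sumr_ge0.
have [y Xy yE] := convex_cone cX (Xr ord0) Xz (t0 ord0) S0.
exists (y - v0); first by rewrite addrC subrK.
rewrite zE scalerBr -yE !scalerDr addrACA -scalerDl.
by rewrite [RHS]addrAC subrr add0r.
Qed.

(** Sup norm of the coordinates in the basis of rows of [M], scaled so that the unit ball about the
    barycentre fits in the simplex. *)
Definition body_seminorm (M : 'M[R]_n) : V -> R :=
  mxseminorm ((n.+1%:R ^+ 2) *: invmx M).

(** Barycentre of the simplex with vertices [v0] and [v0 + row i M]. *)
Definition body_center (v0 : V) (M : 'M[R]_n) : V :=
  v0 + \sum_i n.+1%:R^-1 *: row i M.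

Lemma body_seminormE M x : body_seminorm M x = n.+1%:R ^+ 2 * `|x *m invmx M|.
Proof.
rewrite /body_seminorm /mxseminorm -scalemxAr normrZ ger0_norm//.
Qed.

Lemma body_seminormP M : is_seminorm (body_seminorm M).
Proof. exact: mxseminormP. Qed.

Lemma body_center_mem (X : set V) (v0 : V) (M : 'M[R]_n) x : convex_set X ->
  X v0 -> (forall i, X (v0 + row i M)) -> M \in unitmx ->
  body_seminorm M x < 1 -> X (body_center v0 M + x).
Proof.
move=> cX Xv0 XM uM; rewrite body_seminormE => xlt.
have n0 : 0 < n.+1%:R :> R by rewrite ltr0n.
set b := x *m invmx M in xlt.
have bi i : `|b 0 i| < n.+1%:R^-1 ^+ 2.
  rewrite exprVn -[ltRHS]mul1r ltr_pdivlMr ?exprn_gt0// mulrC.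
  by apply: le_lt_trans xlt; rewrite ler_wpM2l ?exprn_ge0// mx_norm_ler_coord.
have n1 : n.+1%:R^-1 <= 1 :> R by rewrite invf_le1// ler1n.
have ni0 : 0 < n.+1%:R^-1 :> R by rewrite invr_gt0.
have t0 i : 0 <= n.+1%:R^-1 + b 0 i.
  have := bi i; rewrite ltr_norml expr2 => /andP[bl _].
  have : n.+1%:R^-1 * n.+1%:R^-1 <= n.+1%:R^-1 :> R by rewrite ler_piMl// ltW.
  by move: (n.+1%:R^-1) bl => u ? ?; lra.
have -> : body_center v0 M + x = v0 + \sum_i (n.+1%:R^-1 + b 0 i) *: row i M.
  rewrite /body_center -addrA; congr (_ + _).
  have -> : x = \sum_i b 0 i *: row i M by rewrite -mulmx_sum_row mulmxKV.
  by rewrite -big_split/=; apply: eq_bigr => i _; rewrite scalerDl.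
have [z Xz ->] := convex_cone_sum cX Xv0 XM t0.
set S := \sum_i _.
have S0 : 0 <= S by apply: sumr_ge0.
(* With u = 1/(n+1), the sum is at most n u + n u^2 = (1 - u)(1 + u). *)
have S1 : S <= 1.
  apply: (@le_trans _ _ (\sum_(i < n) (n.+1%:R^-1 + n.+1%:R^-1 ^+ 2))).
    by apply: ler_sum => i _; rewrite lerD2l; apply: ltW; apply: le_lt_trans (bi i); exact: ler_norm.
  rewrite sumr_const card_ord -[_ *+ n]mulr_natl expr2.
  have nE : n%:R = n.+1%:R - 1 :> R by rewrite -natr1 addrK.
  have uE : n.+1%:R * n.+1%:R^-1 = 1 :> R by rewrite divff// gt_eqF.
  rewrite nE mulrBl mulrDr mulrA uE mul1r.
  by move: (n.+1%:R^-1) ni0 => u ni0; nra.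
have -> : v0 + S *: z = (1 - S) *: v0 + S *: (v0 + z).
  by rewrite scalerDr addrA -scalerDl subrK scale1r.
by move/convex_setP : cX; apply => //; rewrite ?subr_ge0// subrK.
Qed.

Lemma mu_translate (A : set V) (c : V) : mu (homothety 1 c A) = mu A.
Proof. by rewrite mu_homothety// expr1n mul1e. Qed.

Lemma convex_translate (X : set V) (c : V) : convex_set X ->
  convex_set (homothety 1 c X).
Proof.
move=> /convex_setP cX; rewrite homothetyE//; apply/convex_setP => x y a b /=.
rewrite invr1 !scale1r => Xx Xy a0 b0 ab.
have -> : a *: x + b *: y - c = a *: (x - c) + b *: (y - c).
  by rewrite !scalerBr addrACA -opprD -scalerDl ab scale1r.
exact: cX.
Qed.

Lemma body_bounded (X : set V) (v0 : V) (M : 'M[R]_n) : convex_set X ->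
  X v0 -> (forall i, X (v0 + row i M)) -> M \in unitmx ->
  (0 < mu X)%E -> (mu X < +oo)%E ->
  exists B, forall x, X x -> body_seminorm M (x - body_center v0 M) <= B.
Proof.
move=> cX Xv0 XM uM X0 Xoo.
set c := body_center v0 M; set e := body_seminorm M.
have eP : is_seminorm e := body_seminormP M.
have e0 := mu_ball_gt0 eP X0.
have trE x : X x <-> homothety 1 (- c) X (x - c).
  by rewrite homothetyE//= invr1 scale1r opprK subrK.
have eX : eball e 1 `<=` homothety 1 (- c) X.
  by move=> x ex; rewrite -[x](addrK c); apply/trE; rewrite addrC; exact: body_center_mem.
have efin : mu (eball e 1) \is a fin_num.
  rewrite ge0_fin_numE ?outer_measure_ge0//; apply: le_lt_trans Xoo.
  by rewrite -(mu_translate X (- c)); exact: le_outer_measure.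
have f0 : 0 < fine (mu (eball e 1)) by rewrite fine_gt0// e0 -ge0_fin_numE ?outer_measure_ge0.
have Xfin : mu X \is a fin_num by rewrite ge0_fin_numE ?outer_measure_ge0.
exists (2 ^+ n.+1 * fine (mu X) / fine (mu (eball e 1))) => x /trE Xx.
have := stretch eP (convex_translate (c := - c) cX) eX Xx.
by rewrite mu_translate -(fineK efin) -(fineK Xfin) -!EFinM lee_fin ler_pdivlMr.
Qed.

Lemma det_le (A : 'M[R]_n) (B : R) : (forall i j, `|A i j| <= B) ->
  `|\det A| <= n`!%:R * B ^+ n.
Proof.
move=> AB; apply: (le_trans (ler_norm_sum _ _ _)).
have -> : n`!%:R * B ^+ n = \sum_(s : 'S_n) B ^+ n.
  by rewrite sumr_const card_Sn mulr_natl.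
apply: ler_sum => s _; rewrite normrM normr_sign mul1r normr_prod.
have -> : B ^+ n = \prod_(i < n) B by rewrite prodr_const card_ord.
by apply: ler_prod => i _; rewrite normr_ge0 AB.
Qed.

(** Cramer's rule: the cofactors along row [i] are those of [M]. *)
Lemma det_replace_row (M : 'M[R]_n) (i : 'I_n) (x : V) : M \in unitmx ->
  \det (\matrix_(k, j) if k == i then x 0 j else M k j) = (x *m invmx M) 0 i * \det M.
Proof.
move=> uM; set N := (\matrix_(k, j) _).
rewrite (expand_det_row N i) /invmx uM -scalemxAr mxE mulrAC mulVf ?mul1r; last first.
  by rewrite unitmxE unitfE in uM.
rewrite mxE; apply: eq_bigr => j _; rewrite !mxE eqxx; congr (_ * _).
rewrite /cofactor; congr (_ * \det _); apply/matrixP => k l; rewrite !mxE.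
by rewrite eq_sym (negbTE (neq_lift _ _)).
Qed.

(* Among the simplices of K with vertex v0, one of nearly maximal volume gives
   coordinates in which all of K is bounded by 2. *)
Lemma exists_body (K : set V) : convex_set K -> (0 < mu K)%E -> (mu K < +oo)%E ->
  exists (e : V -> R) (c : V), [/\ is_seminorm e,
    forall x, e x < 1 -> K (c + x) &
    forall x, K x -> e (x - c) <= 3 * n.+1%:R ^+ 2].
Proof.
move=> cK K0 Koo.
have [v0 Kv0] : exists v0, K v0.
  apply: contrapT => /forallNP nK; move: K0.
  by rewrite (_ : K = set0) ?outer_measure0 ?ltxx//; apply/seteqP; split => x // /nK.
have [M1 uM1 KM1] := exists_free_rows v0 K0.
pose D : set R := [set `|\det M| | M in [set M : 'M[R]_n | forall i, K (v0 + row i M)]].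
(* [B] may depend on [K]: it only serves to show that [D] has a supremum. *)
have [B eB] := body_bounded cK Kv0 KM1 uM1 K0 Koo.
have Dub : ubound D ((n`!%:R * (B + B) ^+ n) / `|\det (invmx M1)|).
  move=> _ [M KM <-].
  have d0 : 0 < `|\det (invmx M1)|.
    by rewrite normr_gt0 -unitfE -unitmxE unitmx_inv.
  rewrite ler_pdivlMr// -normrM -det_mulmx; apply: det_le => i j.
  have -> : (M *m invmx M1) i j = (row i M *m invmx M1) 0 j by rewrite -row_mul !mxE.
  apply: (le_trans (mx_norm_ler_coord _ _)).
  have eM := eB _ (KM i); have ev := eB _ Kv0.
  have eP := body_seminormP M1.
  have : body_seminorm M1 (row i M) <= B + B.
    have -> : row i M = (v0 + row i M - body_center v0 M1) - (v0 - body_center v0 M1).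
      by rewrite opprB addrA subrK addrAC subrr add0r.
    apply: (le_trans (semin_leD eP _ _)); rewrite (seminN eP); exact: lerD.
  rewrite body_seminormE; apply: le_trans; rewrite ler_peMl// exprn_ege1//.
  by rewrite ler1n.
have D1 : D `|\det M1| by exists M1.
have hasD : has_sup D by split; [exists `|\det M1| | exists ((n`!%:R * (B + B) ^+ n) / `|\det (invmx M1)|)].
have supD0 : 0 < sup D.
  apply: (@lt_le_trans _ _ `|\det M1|); last exact: sup_upper_bound.
  by rewrite normr_gt0 -unitfE -unitmxE.
(* [K] need not be closed, so the supremum may not be attained; half of it is enough. *)
have [_ [M KM <-] Mlt] : exists2 d, D d & sup D / 2 < d.
  have [d Dd] := @sup_adherent _ D (sup D / 2) ltac:(lra) hasD.
  by move=> ?; exists d => //; lra.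
have uM : M \in unitmx by rewrite unitmxE unitfE -normr_gt0; lra.
exists (body_seminorm M), (body_center v0 M); split; first exact: body_seminormP.
  by move=> x; exact: body_center_mem.
move=> x Kx; rewrite body_seminormE mulrC ler_wpM2r ?exprn_ge0//.
have -> : (x - body_center v0 M) *m invmx M = (x - v0) *m invmx M - const_mx n.+1%:R^-1.
  rewrite /body_center opprD addrA mulmxBl; congr (_ - _).
  rewrite -[RHS](mulmxK uM); congr (_ *m _); rewrite mulmx_sum_row.
  by apply: eq_bigr => i _; rewrite mxE.
apply: (le_trans (ler_normB _ _)).
have c1 : `|const_mx n.+1%:R^-1 : V| <= 1.
  rewrite /Num.Def.normr/= mx_normrE; apply/bigmax_leP; split => // i _ /=.
  by rewrite mxE ger0_norm// invf_le1// ler1n.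
(* Replacing edge i by x - v0 multiplies |det M| by the i-th coordinate, yet stays below sup D < 2
   |det M|. Moving the origin to the barycentre adds at most 1, whence the 3. *)
suff x2 : `|(x - v0) *m invmx M| <= 2 by lra.
rewrite /Num.Def.normr/= mx_normrE; apply/bigmax_leP; split => // -[i0 i] _ /=.
rewrite (ord1 i0).
pose N : 'M[R]_n := \matrix_(k, j) if k == i then (x - v0) 0 j else M k j.
have DN : D `|\det N|.
  exists N => // k; have [->|ki] := eqVneq k i.
    have -> : row i N = x - v0 by apply/rowP => j; rewrite !mxE eqxx.
    by rewrite addrC subrK.
  have -> : row k N = row k M by apply/rowP => j; rewrite !mxE (negbTE ki).
  exact: KM.
have := sup_upper_bound hasD DN; rewrite det_replace_row// normrM => H.
rewrite -(ler_pM2r (x := `|\det M|)); [lra|].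
by rewrite normr_gt0 -unitfE -unitmxE.
Qed.

End john.

(** * The theorem *)

Section hull.
Variables (R : realType) (n : nat).
Local Notation V := 'rV[R]_n.
Local Notation mu := (lebesgue_outer R n).

Lemma convex_hull_convex (A : set V) : convex_set (convex_hull A).
Proof.
move=> x y l xA yA; rewrite inE in xA; rewrite inE in yA; rewrite inE => C [cC AC].
by have := cC x y l (mem_set (xA C (conj cC AC))) (mem_set (yA C (conj cC AC))); rewrite inE.
Qed.

Lemma mu_hull_translate (X Y : set V) (c : V) :
  mu (convex_hull (X `|` Y)) <=
  mu (convex_hull (homothety 1 c X `|` homothety 1 c Y)).
Proof.
rewrite -(mu_translate (convex_hull (homothety 1 c X `|` _)) (- c)).
apply: le_outer_measure; apply: smallest_sub.
  exact/convex_translate/convex_hull_convex.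
move=> x XYx; rewrite homothetyE//= invr1 scale1r opprK => C [_]; apply.
by case: XYx => [Xx|Yx]; [left|right]; exists x; rewrite ?scale1r.
Qed.

(** Here k, x, y, d, l, b stand for the volumes of X ∩ Y, X, Y, X Δ Y, the hull and E. If k <= d,
    the larger of x and y is at most 2d, so l is at most 2ad/b times the smaller, and 1/b <= g/k. If
    d < k, divide l <= k + a d by the minimum, which is at least k. *)
Lemma quotient_le (k x y d l b a g : R) :
  (0 < k -> 0 < b -> 0 <= a -> 0 <= g -> k <= x -> k <= y -> 0 <= d ->
   x <= k + d -> y <= k + d -> k <= g * b ->
   (k <= d -> l * b <= a * (x * y)) -> (d < k -> l <= k + a * d) ->
   l / Num.min x y - 1 <= (a + 2 * a * g) * (d / k))%R.
Proof.
move=> k0 b0 a0 g0 kx ky d0 xkd ykd kgb far near.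
set m := Num.min x y.
have km : (k <= m)%R by rewrite le_min kx.
have m0 : (0 < m)%R by apply: lt_le_trans km.
have dk0 : (0 <= d / k)%R by rewrite divr_ge0// ltW.
have ag0 : (0 <= 2 * a * g)%R by rewrite !mulr_ge0.
have [dk|kd] := ltP d k.
  apply: (@le_trans _ _ (a * (d / k))%R); last by rewrite ler_wpM2r// lerDl.
  rewrite lerBlDr ler_pdivrMr// (le_trans (near dk))// mulrDl mul1r addrC.
  apply: lerD => //; rewrite mulrA -[leLHS]mulr1 -!mulrA ler_wpM2l//.
  by rewrite ler_wpM2l// mulrC ler_pdivlMr// mul1r.
have xy : (x * y <= m * (2 * d))%R.
  have [xy|/ltW yx] := leP x y.
    by rewrite /m min_l// ler_wpM2l//; [lra|lra].
  by rewrite /m min_r// mulrC ler_wpM2l//; [lra|lra].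
apply: (@le_trans _ _ (2 * a * g * (d / k))%R); last by rewrite ler_wpM2r// lerDr.
rewrite lerBlDr ler_wpDr// ler_pdivrMr//.
rewrite -(ler_pM2r b0) (le_trans (far kd))//.
apply: (@le_trans _ _ (a * (m * (2 * d)))%R); first by rewrite ler_wpM2l.
have -> : (2 * a * g * (d / k) * m * b = (a * (m * (2 * d))) * (g * b / k))%R by ring.
rewrite ler_peMr//; first by rewrite !mulr_ge0// ltW.
by rewrite ler_pdivlMr// mul1r.
Qed.

End hull.

Theorem theorem1p7 (R : realType) (n : nat) :
  exists c : R, (0 < c)%R /\
    forall X Y : set 'rV[R]_n,
      convex_set X -> convex_set Y ->
      lebesgue_rV X < +oo -> lebesgue_rV Y < +oo ->
      0 < lebesgue_rV (X `&` Y) ->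
      lebesgue_rV (convex_hull (X `|` Y)) /
        mine (lebesgue_rV X) (lebesgue_rV Y) - 1
      <= c%:E * (lebesgue_rV (X `+` Y) / lebesgue_rV (X `&` Y)).
Proof.
(* The radius from [exists_body], plus 1 so that an open ball contains the translate of K. *)
pose C := (3 * n.+1 ^ 2).+1.
(* [stretch] for a body of volume at most 2|K| <= 2 C^n |E| gives radius 2^(n+2) C^n; adding 1 makes
   the bound strict. *)
pose r := (2 ^ n.+2 * C ^ n).+1.
(* The first summand serves [mu_hull_le], the second [mu_hull_le_near]. *)
pose a : R := (16 ^+ n + (1 + 2 * (4 * r%:R * 2 ^+ n * (2 * r)%:R ^+ n)))%R.
pose g : R := (C ^ n)%:R%R.
have a1 : (1 <= a)%R.
  have : (0 <= 16 ^+ n :> R)%R by rewrite exprn_ge0.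
  have : (0 <= 4 * r%:R * 2 ^+ n * (2 * r)%:R ^+ n :> R)%R.
    by rewrite !mulr_ge0 ?exprn_ge0.
  by rewrite /a => ? ?; lra.
have g0 : (0 <= g)%R by exact: ler0n.
have a0 : (0 <= a)%R by lra.
exists (a + 2 * a * g)%R; split.
  by rewrite ltr_pwDl// ?mulr_ge0//; lra.
move=> X Y cX cY Xoo Yoo K0.
pose mu := lebesgue_outer R n.
rewrite -[@lebesgue_rV R n]/(mu : set 'rV[R]_n -> \bar R) in Xoo Yoo K0 *.
set K := X `&` Y in K0 *.
have cK : convex_set K.
  apply/convex_setP => x y s t [Xx Yx] [Xy Yy] s0 t0 st.
  by split; [move/convex_setP : cX|move/convex_setP : cY]; apply.
have Koo : mu K < +oo by apply: le_lt_trans Xoo; apply: le_outer_measure => x [].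
have [e [c [eP eK Ke]]] := exists_body cK K0 Koo.
pose tr := homothety 1 (- c) : set 'rV[R]_n -> set 'rV[R]_n.
have trE A x : tr A x = A (x + c)%R.
  by rewrite /tr homothetyE//= invr1 scale1r opprK.
have mu_tr A : mu (tr A) = mu A by exact: mu_translate.
have eX : eball e 1 `<=` tr X by move=> x /eK; rewrite trE addrC => -[].
have eY : eball e 1 `<=` tr Y by move=> x /eK; rewrite trE addrC => -[].
have ctX : convex_set (tr X) by exact: convex_translate.
have ctY : convex_set (tr Y) by exact: convex_translate.
have e0 := mu_ball_gt0 eP K0.
have eoo : mu (eball e 1) < +oo.
  by apply: le_lt_trans Xoo; rewrite -(mu_tr X); exact: le_outer_measure.
have KC : mu K <= (g)%:E * mu (eball e 1).
  rewrite /g natrX -mu_eball// -mu_tr; apply: le_outer_measure => x.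
  rewrite trE => /Ke; rewrite addrK /eball/= => /le_lt_trans; apply.
  by rewrite -natrX -natrM ltr_nat.
have Doo : mu (X `+` Y) < +oo.
  apply: (@le_lt_trans _ _ (mu X + mu Y)); last by rewrite lte_add_pinfty.
  apply: le_trans (outer_measureU2 _ _ _).
  by apply: le_outer_measure => x [[? _]|[? _]]; [left|right].
have XKD : mu X <= mu K + mu (X `+` Y).
  apply: le_trans (outer_measureU2 _ _ _); apply: le_outer_measure => x Xx.
  by have [Yx|nY] := pselect (Y x); [left|right; left].
have YKD : mu Y <= mu K + mu (X `+` Y).
  apply: le_trans (outer_measureU2 _ _ _); apply: le_outer_measure => y Yy.
  by have [Xy|nX] := pselect (X y); [left|right; right].
have KX : mu K <= mu X by apply: le_outer_measure => x [].
have KY : mu K <= mu Y by apply: le_outer_measure => x [].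
have [x xE] := mu_fin_real Xoo; have [y yE] := mu_fin_real Yoo; have [k kE] := mu_fin_real Koo.
have [d dE] := mu_fin_real Doo; have [b bE] := mu_fin_real eoo.
have d0 : (0 <= d)%R by rewrite -lee_fin -dE outer_measure_ge0.
have hull_tr : mu (convex_hull (X `|` Y)) <= mu (convex_hull (tr X `|` tr Y)).
  exact: mu_hull_translate.
have far := mu_hull_le eP ctX ctY eX eY e0 ltac:(by rewrite mu_tr) ltac:(by rewrite mu_tr).
rewrite !mu_tr xE yE bE -!EFinM in far.
rewrite xE yE kE dE bE -?EFinM -?EFinD ?lte_fin ?lee_fin in K0 KX KY XKD YKD KC e0.
have Lfin : exists l, mu (convex_hull (X `|` Y)) = l%:E.
  apply: mu_fin_real; apply: le_lt_trans hull_tr _.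
  (* An infinite hull would make the left side of [far] infinite, as |E| > 0. *)
  rewrite ltNge; apply/negP; rewrite leye_eq => /eqP hoo.
  by move: far; rewrite hoo gt0_mulye ?lte_fin.
have [l lE] := Lfin.
have far' : (l * b <= a * (x * y))%R.
  have : (l * b <= 16 ^+ n * (x * y))%R.
    rewrite -lee_fin; apply: le_trans far; rewrite EFinM -lE.
    by rewrite lee_wpmul2r// lee_fin ltW.
  move=> /le_trans; apply; rewrite ler_wpM2r ?mulr_ge0//; try lra.
  by rewrite /a lerDl addr_ge0 ?mulr_ge0 ?exprn_ge0.
have near : (d < k)%R -> (l <= k + a * d)%R.
  move=> dk.
  have bound Z : convex_set Z -> eball e 1 `<=` Z -> mu Z <= (2 * k)%R%:E ->
      forall z, Z z -> (e z < r%:R)%R.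
    move=> cZ eZ Zk z Zz; have := stretch eP cZ eZ Zz; rewrite bE => H.
    have : (e z * b <= 2 ^+ n.+1 * (2 * k))%R.
      rewrite -lee_fin EFinM; apply: (le_trans H); rewrite EFinM.
      by rewrite lee_wpmul2l// lee_fin exprn_ge0.
    move=> eb; rewrite -(ltr_pM2r e0) (le_lt_trans eb)//.
    apply: (@le_lt_trans _ _ (2 ^+ n.+2 * (g * b))%R).
      by rewrite mulrA -exprSr ler_wpM2l ?exprn_ge0.
    rewrite mulrA ltr_pM2r// /r /g -natrX -natrM ltr_nat//.
  have tX : forall z, tr X z -> (e z < r%:R)%R.
    by apply: bound => //; rewrite mu_tr xE lee_fin; lra.
  have tY : forall z, tr Y z -> (e z < r%:R)%R.
    by apply: bound => //; rewrite mu_tr yE lee_fin; lra.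
  have := mu_hull_le_near eP ltac:(by rewrite bE lte_fin) ltac:(by rewrite bE ltry) ctX ctY eX eY tX tY.
  have -> : tr X `&` tr Y = tr K by rewrite /tr !homothetyE.
  have -> : tr X `+` tr Y = tr (X `+` Y) by rewrite /tr !homothetyE.
  rewrite !mu_tr kE dE -EFinM -EFinD => H.
  have := le_trans hull_tr H; rewrite lE lee_fin => /le_trans; apply; rewrite lerD2l ler_wpM2r//.
  by rewrite /a lerDr exprn_ge0.
have m0 : (Num.min x y != 0)%R.
  by rewrite gt_eqF// lt_min; apply/andP; split; lra.
rewrite lE xE yE dE kE -EFin_min !inver (negbTE m0) gt_eqF// -!EFinM -EFinB lee_fin.
exact: (quotient_le (b := b)).
Qed.
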